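(* Let $a,b,c$ be positive numbers with $a<b<c$ and $b-a<c_0<a$, where $c_0=c-\lfloor c/b\rfloor b$. Set $c_1=\lfloor c/b\rfloor b-\lfloor \lfloor c/b\rfloor b/a\rfloor a$. Suppose $\lfloor c/b\rfloor\ge2$. (IX) If $c_1>2a-b$, then $\mathcal G(\chi_{[0,c)},a\mathbb Z\times\mathbb Z/b)$ is a Gabor frame. (X) If $c_1=2a-b$, then $\mathcal G(\chi_{[0,c)},a\mathbb Z\times\mathbb Z/b)$ is a Gabor frame if and only if $a/b=p/q$ for some coprime positive integers $p,q$ with $c_0\le b-a+b/q$ and $\lfloor c/b\rfloor+1=p$. (XI) If $c_1=0$, then $\mathcal G(\chi_{[0,c)},a\mathbb Z\times\mathbb Z/b)$ is a Gabor frame if and only if $a/b=p/q$ for some coprime positive integers $p,q$ with $c_0\ge a-b/q$ and $\lfloor c/b\rfloor=p$.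
   Context: For $\phi\in L^2(\mathbb R)$ and $a,b>0$, the Gabor system is $\mathcal G(\phi,a\mathbb Z\times\mathbb Z/b)=\{e^{-2\pi i n t/b}\phi(t-ma): (m,n)\in\mathbb Z\times\mathbb Z\}$. It is called a Gabor frame if it is a frame for $L^2(\mathbb R)$: there are constants $0<A\le B<\infty$ such that $A\|f\|_2^2\le\sum_{\psi\in\mathcal G}|\langle f,\psi\rangle|^2\le B\|f\|_2^2$ for all $f\in L^2(\mathbb R)$. $\chi_E$ is the indicator function of $E$ and $\lfloor x\rfloor$ is the integer part of $x$. *)

(* Defs.v *)
From HB Require Import structures.
From mathcomp Require Import all_boot all_order all_algebra.
From mathcomp Require Import all_classical all_reals all_analysis.
Set Implicit Arguments. Unset Strict Implicit. Unset Printing Implicit Defensive.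
Import Order.TTheory GRing.Theory Num.Theory.
Local Open Scope classical_set_scope.
Local Open Scope ring_scope.

(* A complex-valued function R -> C is represented by its real and imaginary
   parts (fr, fi) : (R -> R) * (R -> R). *)

Section Gabor.
Variable R : realType.
Local Notation mu := (@lebesgue_measure R).

Definition L2r (f : R -> R) : Prop :=
  measurable_fun [set: R] f /\
  (\int[mu]_x ((f x) ^+ 2)%:E < +oo)%E.

Definition L2c (fr fi : R -> R) : Prop := L2r fr /\ L2r fi.

Definition sqnorm2 (fr fi : R -> R) : \bar R :=
  (\int[mu]_x ((fr x) ^+ 2 + (fi x) ^+ 2)%:E)%E.

(* <f, g> = \int f conj(g), returned as (real part, imaginary part) *)
Definition cinner (fr fi gr gi : R -> R) : R * R :=
  (Rintegral mu [set: R] (fun x => fr x * gr x + fi x * gi x),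
   Rintegral mu [set: R] (fun x => fi x * gr x - fr x * gi x)).

(* Gabor atom  psi_{m,n}(t) = e^{-2 pi i n t / b} phi(t - m a),
   with phi = ur + i ui;  e^{-i th} (ur + i ui) =
   (cos th ur + sin th ui) + i (cos th ui - sin th ur). *)
Definition gabor_angle (b : R) (n : int) (t : R) : R :=
  2 * pi * n%:~R * t / b.

Definition gabor_atom_re (ur ui : R -> R) (a b : R) (m n : int) (t : R) : R :=
  cos (gabor_angle b n t) * ur (t - m%:~R * a)
  + sin (gabor_angle b n t) * ui (t - m%:~R * a).

Definition gabor_atom_im (ur ui : R -> R) (a b : R) (m n : int) (t : R) : R :=
  cos (gabor_angle b n t) * ui (t - m%:~R * a)
  - sin (gabor_angle b n t) * ur (t - m%:~R * a).

Definition gabor_coef2 (ur ui : R -> R) (a b : R) (fr fi : R -> R)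
    (mn : int * int) : \bar R :=
  let z := cinner fr fi (gabor_atom_re ur ui a b mn.1 mn.2)
                        (gabor_atom_im ur ui a b mn.1 mn.2) in
  ((z.1) ^+ 2 + (z.2) ^+ 2)%:E.

Definition gabor_frame (ur ui : R -> R) (a b : R) : Prop :=
  exists A B : R, 0 < A /\ A <= B /\
    forall fr fi : R -> R, L2c fr fi ->
      (A%:E * sqnorm2 fr fi <= \esum_(mn in [set: int * int]) gabor_coef2 ur ui a b fr fi mn)%E /\
      (\esum_(mn in [set: int * int]) gabor_coef2 ur ui a b fr fi mn <= B%:E * sqnorm2 fr fi)%E.

Definition chi0 (c : R) (t : R) : R := if (0 <= t) && (t < c) then 1 else 0.

Definition zero_fun (t : R) : R := 0.

End Gabor.

(* Main.v *)
(** Parseval on the windows [m a, m a + b) turns the frame sum of f into the sum over m of the squared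
    L2 norms over one period of the window sums of f, that is, the sums of the values of f on the points
    of x + b Z lying in [m a, m a + c).  The difference of two consecutive window sums at x is
    f (x + (k + 1) b) - f x, - f x or f (x + k b) - f x, with k the integer part of c / b, according to
    whether x mod a lies before, in or after the hole [c0 + a - b, c0).  The two translations act on
    x mod a as small rotations pushing every orbit into the hole after boundedly many steps, where f is
    controlled; this gives a lower bound, unless c1 = 2 a - b or c1 = 0, when the points before
    (respectively after) the hole are fixed.  A fixed class of points is recovered from a single window
    sum when a window meets it only once; when two fixed classes meet the same windows, their difference
    is a bounded function all of whose window sums vanish, and truncating it defeats any lower bound.
    The number of fixed classes is a statement about the multiples of b modulo a. *)

(* The hole has length b - a, and this is what makes the rotations usable. Modulo a, translation by
   (k + 1) b moves a point before the hole to the right by c1 + b - 2 a, and translation by k b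
   moves a point after the hole to the left by a - c1. When c1 > 2 a - b both steps are positive and
   at most b - a, so no orbit can jump over the hole. When one step degenerates to 0 the other is
   exactly b - a, so one side is still recovered and only the other side poses a question. On the
   degenerate side P b is a multiple of a, where P is k + 1 or k, and a window starting there
   contains exactly P points of x + b Z. If a / b = P / q in lowest terms, these points have
   residues modulo a spaced by b / q, so a side of length at most b / q contains only one of them.
   The two sides have lengths c0 + a - b and a - c0, which is the origin of the inequalities on c0.
   All recovery estimates are pointwise, with constants independent of the function and the point,
   so they survive integration. *)
Require Import Defs.
From HB Require Import structures.
From mathcomp Require Import all_boot all_order all_algebra.
From mathcomp Require Import all_classical all_reals all_analysis.
From mathcomp Require Import measurable_realfun.
From mathcomp Require Import ring lra.
Set Implicit Arguments. Unset Strict Implicit. Unset Printing Implicit Defensive.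
Import Order.TTheory GRing.Theory Num.Theory.
Import numFieldNormedType.Exports.
Local Open Scope classical_set_scope.
Local Open Scope ring_scope.

(** * Square integrable functions on a measurable set *)

Section L2on.
Context d (T : measurableType d) (R : realType).
Variables (mu : {measure set T -> \bar R}) (D : set T).
Hypothesis mD : measurable D.
Implicit Types f g h : T -> R.

Definition L2on f :=
  measurable_fun D f /\ mu.-integrable D (fun x => (f x ^+ 2)%:E).

Definition dotp f g : R := Rintegral mu D (fun x => f x * g x).

Lemma L2onM f g : L2on f -> L2on g -> mu.-integrable D (EFin \o (fun x => f x * g x)).
Proof.
move=> [mf f2] [mg g2].
apply: (le_integrable mD _ _ (integrableD mD f2 g2)).
  by apply/measurable_EFinP/measurable_funM.
move=> x _ /=; rewrite lee_fin [leRHS]ger0_norm ?addr_ge0 ?sqr_ge0//.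
rewrite ler_norml; apply/andP; split.
  have := sqr_ge0 (f x + g x); have := sqr_ge0 (f x); have := sqr_ge0 (g x); nra.
have := sqr_ge0 (f x - g x); have := sqr_ge0 (f x); have := sqr_ge0 (g x); nra.
Qed.

Lemma L2onD f g : L2on f -> L2on g -> L2on (fun x => f x + g x).
Proof.
move=> Lf Lg; split; first exact: measurable_funD Lf.1 Lg.1.
have -> : (fun x => ((f x + g x) ^+ 2)%:E) =
   ((fun x => (f x ^+ 2)%R%:E) \+ ((EFin \o (fun x => f x * g x)%R) \+
    (EFin \o (fun x => f x * g x)%R) \+ (fun x => (g x ^+ 2)%R%:E)))%E.
  by apply/funext => x /=; congr EFin; ring.
by apply: integrableD => //; [exact: Lf.2|apply: integrableD => //; [
  apply: integrableD => //; exact: L2onM|exact: Lg.2]].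
Qed.

Lemma L2onZ c f : L2on f -> L2on (fun x => c * f x).
Proof.
move=> Lf; split; first exact: measurable_funM (measurable_cst _) Lf.1.
have -> : (fun x => ((c * f x) ^+ 2)%:E) =
   (fun x => (c ^+ 2)%R%:E * (f x ^+ 2)%R%:E)%E.
  by apply/funext => x /=; congr EFin; ring.
by apply: integrableZl => //; exact: Lf.2.
Qed.

Lemma L2onB f g : L2on f -> L2on g -> L2on (fun x => f x - g x).
Proof.
move=> Lf /(L2onZ (-1))Lg.
rewrite (_ : (fun x => _) = (fun x => f x + -1 * g x)); first exact: L2onD.
by apply/funext => x; ring.
Qed.

Lemma L2on0 : L2on (fun=> 0).
Proof.
split; first exact: measurable_cst.
by rewrite (_ : (fun _ => _) = cst 0%E) ?expr0n//; exact: integrable0.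
Qed.

Lemma L2on_sum (I : Type) (r : seq I) (F : I -> T -> R) :
  (forall i, L2on (F i)) -> L2on (fun x => \sum_(i <- r) F i x).
Proof.
move=> LF; elim: r => [|i r ih].
  by under eq_fun do rewrite big_nil; exact: L2on0.
by under eq_fun do rewrite big_cons; exact: L2onD.
Qed.

Lemma L2on_bounded f (K : R) : (mu D < +oo)%E -> measurable_fun D f ->
  (forall x, D x -> `|f x| <= K) -> L2on f.
Proof.
move=> muD mf fK; split => //.
apply: (@measurable_bounded_integrable _ _ _ mu (fun x => f x ^+ 2)) => //.
  exact: measurable_funX.
exists (K ^+ 2); split; first exact: num_real.
move=> M KM x Dx /=; rewrite ger0_norm ?sqr_ge0// -real_normK ?num_real//.
apply/ltW/(le_lt_trans _ KM); rewrite lerXn2r ?nnegrE//; last exact: fK.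
exact: le_trans (fK _ Dx).
Qed.

Lemma dotpC f g : dotp f g = dotp g f.
Proof. by apply: eq_Rintegral => x _; rewrite mulrC. Qed.

Lemma dotpDl f g h : L2on f -> L2on g -> L2on h ->
  dotp (fun x => f x + g x) h = dotp f h + dotp g h.
Proof.
move=> Lf Lg Lh; rewrite /dotp -RintegralD//; try exact: L2onM.
by apply: eq_Rintegral => x _; rewrite mulrDl.
Qed.

Lemma dotpZl c f h : L2on f -> L2on h -> dotp (fun x => c * f x) h = c * dotp f h.
Proof.
move=> Lf Lh; rewrite /dotp -RintegralZl//; last exact: L2onM.
by apply: eq_Rintegral => x _; rewrite mulrA.
Qed.

Lemma dotpDr f g h : L2on f -> L2on g -> L2on h ->
  dotp h (fun x => f x + g x) = dotp h f + dotp h g.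
Proof. by move=> *; rewrite dotpC dotpDl// !(dotpC h). Qed.

Lemma dotpZr c f h : L2on f -> L2on h -> dotp h (fun x => c * f x) = c * dotp h f.
Proof. by move=> *; rewrite dotpC dotpZl// !(dotpC h). Qed.

Lemma dotp_suml (I : Type) (r : seq I) (F : I -> T -> R) h :
  (forall i, L2on (F i)) -> L2on h ->
  dotp (fun x => \sum_(i <- r) F i x) h = \sum_(i <- r) dotp (F i) h.
Proof.
move=> LF Lh; elim: r => [|i r ih].
  rewrite big_nil /dotp; under eq_Rintegral do rewrite big_nil mul0r.
  by rewrite /Rintegral integral0.
rewrite big_cons -ih -dotpDl//; last exact: L2on_sum.
by congr dotp; apply/funext => x; rewrite big_cons.
Qed.

Lemma dotp_ge0 f : 0 <= dotp f f.
Proof. by apply: Rintegral_ge0 => x _; rewrite -expr2 sqr_ge0. Qed.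

Lemma dotp_sqr f : dotp f f = Rintegral mu D (fun x => f x ^+ 2).
Proof. by apply: eq_Rintegral => x _; rewrite expr2. Qed.

Lemma dotpE f : L2on f -> (dotp f f)%:E = (\int[mu]_(x in D) (f x ^+ 2)%:E)%E.
Proof.
by move=> [mf f2]; rewrite dotp_sqr /Rintegral fineK//; exact: integrable_fin_num.
Qed.

Lemma eq_dotp f g f' g' : {in D, f =1 f'} -> {in D, g =1 g'} -> dotp f g = dotp f' g'.
Proof. by move=> ff gg; apply: eq_Rintegral => x xD; rewrite ff// gg. Qed.

Lemma dotp_add_le f g : L2on f -> L2on g ->
  dotp (fun x => f x + g x) (fun x => f x + g x) <= 2 * dotp f f + 2 * dotp g g.
Proof.
move=> Lf Lg.
have := dotp_ge0 (fun x => f x - g x).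
have -> : (fun x => f x - g x) = (fun x => f x + -1 * g x) by apply/funext => x; ring.
have L1 := L2onZ (-1) Lg; have L2 := L2onD Lf L1; have L3 := L2onD Lf Lg.
rewrite !(dotpDl, dotpDr, dotpZl, dotpZr)// (dotpC g f); lra.
Qed.

(** Dominated convergence applied to squares. It serves as the limit theorem of the density
    argument: [u] will be the error of a sequence of approximants and [f] a square integrable bound
    for it. *)
Lemma dominated_L2 (u : nat -> T -> R) f :
  (forall n, measurable_fun D (u n)) -> L2on f ->
  (forall n x, D x -> `|u n x| <= `|f x|) ->
  {ae mu, forall x, D x -> u ^~ x @ \oo --> (0 : R)} ->
  forall e, 0 < e -> exists n, L2on (u n) /\ dotp (u n) (u n) <= e.
Proof.
move=> mu_ Lf uf u0 e e0.
have uf2 n x : D x -> u n x ^+ 2 <= f x ^+ 2.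
  by move=> /(uf n) H; rewrite -(real_normK (num_real (u n x)))
    -(real_normK (num_real (f x))) lerXn2r ?nnegrE.
have Lu n : L2on (u n).
  split; first exact: mu_.
  apply: (le_integrable mD _ _ Lf.2).
    by apply/measurable_EFinP/measurable_funX; exact: mu_.
  by move=> x Dx; rewrite !gee0_abs ?lee_fin ?sqr_ge0//; exact: uf2.
have [|||| _ _ H] := @dominated_convergence _ _ _ mu D mD (fun n x => (u n x ^+ 2)%:E)
  (cst 0%E) (fun x => (f x ^+ 2)%:E) _ _ _ Lf.2 _.
  - by move=> n; apply/measurable_EFinP/measurable_funX; exact: mu_.
  - exact: measurable_cst.
  - apply: filterS u0 => x ux Dx; apply: cvg_EFin; first exact: nearW.
    rewrite [fine \o _](_ : _ = fun n => u n x * u n x); last first.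
      by apply/funext => n /=; rewrite expr2.
    by rewrite -[X in _ --> X](mulr0 0); apply: cvgM; exact: ux.
  - by apply: aeW => x n Dx; rewrite gee0_abs ?lee_fin ?sqr_ge0//; exact: uf2.
move: H; rewrite /= integral0 => /fine_cvg /cvgrPdist_lt /(_ e e0)[n _ /(_ n (leqnn n))/=].
rewrite sub0r normrN -dotpE//= ger0_norm ?dotp_ge0// => /ltW ?; by exists n.
Qed.

End L2on.

(** * Orthogonal systems *)

Section orthogonal_system.
Context d (T : measurableType d) (R : realType).
Variables (mu : {measure set T -> \bar R}) (D : set T).
Hypothesis mD : measurable D.
Variables (N : choiceType) (e : N -> T -> R) (b : R).
Hypothesis b_gt0 : 0 < b.
Hypothesis Le : forall n, L2on mu D (e n).
Hypothesis eO : forall n m, dotp mu D (e n) (e m) = if n == m then b else 0.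
Local Notation dot := (dotp mu D).
Local Notation L2 := (L2on mu D).

Definition comb (X : seq N) (al : N -> R) (x : T) := \sum_(n <- X) al n * e n x.

Definition spanned (p : T -> R) := exists X al, uniq X /\ p = comb X al.

Definition sqdist (f g : T -> R) := dot (fun x => f x - g x) (fun x => f x - g x).

Lemma L2on_comb X al : L2 (comb X al).
Proof. by apply: L2on_sum => // n; exact: L2onZ. Qed.

Lemma L2on_spanned p : spanned p -> L2 p.
Proof. by move=> [X [al [_ ->]]]; exact: L2on_comb. Qed.

Lemma dotp_comb X al g : L2 g ->
  dot g (comb X al) = \sum_(n <- X) al n * dot g (e n).
Proof.
move=> Lg; rewrite dotpC dotp_suml//; last by move=> n; exact: L2onZ.
by apply: eq_bigr => n _; rewrite dotpZl// dotpC.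
Qed.

Lemma dotp_comb_comb X al : uniq X ->
  dot (comb X al) (comb X al) = b * \sum_(n <- X) al n ^+ 2.
Proof.
move=> uX; rewrite dotp_comb; last exact: L2on_comb.
rewrite mulr_sumr big_seq [RHS]big_seq; apply: eq_bigr => n nX.
rewrite dotpC dotp_comb// (bigD1_seq n)//= big1 ?addr0; first by rewrite eO eqxx; ring.
by move=> m mn; rewrite eO eq_sym (negbTE mn) mulr0.
Qed.

Lemma sqdist_comb X al g : uniq X -> L2 g ->
  sqdist g (comb X al) =
  dot g g - 2 * \sum_(n <- X) al n * dot g (e n) + b * \sum_(n <- X) al n ^+ 2.
Proof.
move=> uX Lg; rewrite -dotp_comb// -dotp_comb_comb//.
have Lc := L2on_comb X al; rewrite /sqdist.
have -> : (fun x => g x - comb X al x) = (fun x => g x + -1 * comb X al x).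
  by apply/funext => x; ring.
have L1 := L2onZ mD (-1) Lc; have L2' := L2onD mD Lg L1.
rewrite !(dotpDl, dotpDr, dotpZl, dotpZr)// (dotpC mu D _ g); ring.
Qed.

(** The squared distance from [g] to its orthogonal projection is nonnegative; the coefficients are
    divided by [b] because each [e n] has squared norm [b]. *)
Lemma bessel_inequality X g : uniq X -> L2 g ->
  \sum_(n <- X) dot g (e n) ^+ 2 <= b * dot g g.
Proof.
move=> uX Lg; have := dotp_ge0 mu D (fun x => g x - comb X (fun n => dot g (e n) / b) x).
rewrite -/(sqdist _ _) sqdist_comb//.
have -> : \sum_(n <- X) dot g (e n) / b * dot g (e n) = (\sum_(n <- X) dot g (e n) ^+ 2) / b.
  by rewrite mulr_suml; apply: eq_bigr => n _; ring.
have -> : \sum_(n <- X) (dot g (e n) / b) ^+ 2 = (\sum_(n <- X) dot g (e n) ^+ 2) / b ^+ 2.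
  by rewrite mulr_suml; apply: eq_bigr => n _; rewrite exprMn exprVn.
set S := \sum_(n <- X) _ => H.
have -> : S = b * (S / b) by field; rewrite gt_eqF.
rewrite ler_pM2l// -subr_ge0; apply: le_trans H _.
rewrite le_eqVlt; apply/orP; left; apply/eqP; field; by rewrite gt_eqF.
Qed.

(** The right side minus the left side is the sum of the squares of [dot g (e n) - b * al n]. Thus
    any good approximation, with whatever coefficients, makes Bessel's inequality nearly an
    equality. *)
Lemma best_approximation X al g : uniq X -> L2 g ->
  b * dot g g <= \sum_(n <- X) dot g (e n) ^+ 2 + b * sqdist g (comb X al).
Proof.
move=> uX Lg; rewrite sqdist_comb//.
suff : 0 <= \sum_(n <- X) (dot g (e n) - b * al n) ^+ 2.
  have -> : \sum_(n <- X) (dot g (e n) - b * al n) ^+ 2 =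
    \sum_(n <- X) dot g (e n) ^+ 2 - 2 * b * \sum_(n <- X) al n * dot g (e n)
    + b ^+ 2 * \sum_(n <- X) al n ^+ 2.
    rewrite !mulr_sumr -sumrB -big_split/=; apply: eq_bigr => n _; ring.
  by rewrite -subr_ge0 => H; rewrite -subr_ge0; apply: le_trans H _;
    rewrite le_eqVlt; apply/orP; left; apply/eqP; ring.
by apply: sumr_ge0 => n _; exact: sqr_ge0.
Qed.

Lemma spanned_e n : spanned (e n).
Proof.
exists [:: n], (fun=> 1); split => //.
by apply/funext => x; rewrite /comb big_seq1 mul1r.
Qed.

Lemma spannedZ c p : spanned p -> spanned (fun x => c * p x).
Proof.
move=> [X [al [uX ->]]]; exists X, (fun n => c * al n); split => //.
by apply/funext => x; rewrite /comb mulr_sumr; apply: eq_bigr => n _; rewrite mulrA.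
Qed.

Lemma spannedD p q : spanned p -> spanned q -> spanned (fun x => p x + q x).
Proof.
move=> [X [al [uX ->]]] [Y [be [uY ->]]].
(* The index lists are merged without repetition, each family of coefficients being extended by zero
   outside its own list. *)
exists (undup (X ++ Y)), (fun n => (n \in X)%:R * al n + (n \in Y)%:R * be n).
split; first exact: undup_uniq.
have H (Z W : seq N) (ga : N -> R) x : uniq Z -> uniq W -> {subset Z <= W} ->
    comb Z ga x = \sum_(n <- W) (n \in Z)%:R * ga n * e n x.
  move=> uZ uW ZW; rewrite (bigID (mem Z))/= [X in _ + X]big1 ?addr0; last first.
    by move=> n /negbTE ->; rewrite !mul0r.
  rewrite -big_filter (perm_big Z)/=.
    by rewrite /comb big_seq [RHS]big_seq; apply: eq_bigr => n ->; rewrite mul1r.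
  apply: uniq_perm => //; first exact: filter_uniq.
  by move=> n; rewrite mem_filter; case: (boolP (n \in Z)) => // /ZW.
apply/funext => x.
rewrite (H X (undup (X ++ Y)))// ?undup_uniq//; last first.
  by move=> n; rewrite mem_undup mem_cat => ->.
rewrite (H Y (undup (X ++ Y)))// ?undup_uniq//; last first.
  by move=> n; rewrite mem_undup mem_cat => ->; rewrite orbT.
by rewrite /comb -big_split/=; apply: eq_bigr => n _; rewrite mulrDl.
Qed.

Lemma spanned0 : spanned (fun=> 0).
Proof. by exists [::], (fun=> 0); split => //; apply/funext => x; rewrite /comb big_nil. Qed.

Lemma spanned_sum (I : Type) (r : seq I) (F : I -> T -> R) :
  (forall i, spanned (F i)) -> spanned (fun x => \sum_(i <- r) F i x).
Proof.
move=> sF; elim: r => [|i r ih].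
  by under eq_fun do rewrite big_nil; exact: spanned0.
by under eq_fun do rewrite big_cons; exact: spannedD.
Qed.

(** The closure of the span in L2; completeness of the system means that every square integrable
    function is in it. *)
Definition approximable (g : T -> R) :=
  L2 g /\ forall eps, 0 < eps -> exists p, spanned p /\ sqdist g p <= eps.

Lemma sqdist_triangle f g h : L2 f -> L2 g -> L2 h ->
  sqdist f h <= 2 * sqdist f g + 2 * sqdist g h.
Proof.
move=> Lf Lg Lh; have := dotp_add_le mD (L2onB mD Lf Lg) (L2onB mD Lg Lh).
by rewrite (_ : (fun x => _ + _) = (fun x => f x - h x))//; apply/funext => x; ring.
Qed.

Lemma sqdistxx f : sqdist f f = 0.
Proof.
rewrite /sqdist /dotp; under eq_Rintegral do rewrite subrr mul0r.
by rewrite /Rintegral integral0.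
Qed.

Lemma approximable_spanned p : spanned p -> approximable p.
Proof.
move=> sp; split; first exact: L2on_spanned.
by move=> eps e0; exists p; rewrite sqdistxx; split => //; exact: ltW.
Qed.

Lemma approximable_closed g : L2 g ->
  (forall eps, 0 < eps -> exists h, approximable h /\ sqdist g h <= eps) ->
  approximable g.
Proof.
move=> Lg H; split => // eps e0.
have e4 : 0 < eps / 4 by rewrite divr_gt0.
have [h [[Lh ah] gh]] := H _ e4; have [p [sp hp]] := ah _ e4.
exists p; split => //.
have := sqdist_triangle Lg Lh (L2on_spanned sp); lra.
Qed.

Lemma approximableZ c g : approximable g -> approximable (fun x => c * g x).
Proof.
move=> [Lg ag]; split; first exact: L2onZ.
move=> eps e0.
have c0 : 0 < c ^+ 2 + 1 by rewrite ltr_wpDl ?sqr_ge0.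
have [p [sp gp]] := ag (eps / (c ^+ 2 + 1)) (divr_gt0 e0 c0).
exists (fun x => c * p x); split; first exact: spannedZ.
have Lp := L2on_spanned sp; rewrite /sqdist.
have -> : (fun x => c * g x - c * p x) = (fun x => c * (g x - p x)).
  by apply/funext => x; ring.
have Lgp := L2onB mD Lg Lp.
rewrite dotpZl ?dotpZr//; last exact: L2onZ.
move: gp; rewrite ler_pdivlMr// -/(sqdist g p).
have : 0 <= sqdist g p by exact: dotp_ge0.
by move: (sqdist g p) => s; nra.
Qed.

Lemma approximableD f g : approximable f -> approximable g ->
  approximable (fun x => f x + g x).
Proof.
move=> [Lf af] [Lg ag]; split; first exact: L2onD.
move=> eps e0; have e4 : 0 < eps / 4 by rewrite divr_gt0.
have [p [sp fp]] := af _ e4; have [q [sq gq]] := ag _ e4.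
exists (fun x => p x + q x); split; first exact: spannedD.
have := dotp_add_le mD (L2onB mD Lf (L2on_spanned sp)) (L2onB mD Lg (L2on_spanned sq)).
rewrite (_ : (fun x => _ + _) = (fun x => f x + g x - (p x + q x))).
  by rewrite -!/(sqdist _ _); lra.
by apply/funext => x; ring.
Qed.

Lemma approximable_sum (I : Type) (r : seq I) (F : I -> T -> R) :
  (forall i, approximable (F i)) -> approximable (fun x => \sum_(i <- r) F i x).
Proof.
move=> aF; elim: r => [|i r ih].
  by under eq_fun do rewrite big_nil; exact/approximable_spanned/spanned0.
by under eq_fun do rewrite big_cons; exact: approximableD.
Qed.

Lemma eq_approximable f g : {in D, f =1 g} -> approximable f -> approximable g.
Proof.
move=> fg af; have Lg : L2 g.
  case: af => -[mf f2] _; split; first exact: eq_measurable_fun fg mf.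
  apply: eq_integrable f2 => //.
  by move=> x xD /=; rewrite fg.
apply: approximable_closed => // eps e0; exists f; split => //.
suff -> : sqdist g f = sqdist f f by rewrite sqdistxx ltW.
by apply: eq_dotp => x xD; rewrite fg.
Qed.

Lemma parseval_le g : L2 g ->
  (\esum_(n in [set: N]) (dot g (e n) ^+ 2)%:E <= (b * dot g g)%:E)%E.
Proof.
move=> Lg; apply: ge_ereal_sup => _ [A [finA _] <-].
rewrite fsbig_finite// sumEFin lee_fin.
exact: bessel_inequality.
Qed.

Lemma parseval_identity g : approximable g ->
  (\esum_(n in [set: N]) (dot g (e n) ^+ 2)%:E = (b * dot g g)%:E)%E.
Proof.
move=> [Lg ag]; apply/eqP; rewrite eq_le parseval_le//=.
apply/lee_addgt0Pr => eps e0.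
have [_ [[X [al [uX ->]]] gp]] := ag _ (divr_gt0 e0 b_gt0).
apply: (@le_trans _ _ ((\sum_(n <- X) dot g (e n) ^+ 2)%:E + eps%:E)%E).
  rewrite -EFinD lee_fin; apply: le_trans (best_approximation al uX Lg) _.
  rewrite lerD2l; move: gp; rewrite ler_pdivlMr//; lra.
apply: leeD => //; rewrite -sumEFin; apply: esum_ge.
exists [set` X]; first by split => //; exact: finite_seq.
by rewrite -(fsbig_seq _ _ uX).
Qed.

End orthogonal_system.

(** * Trigonometric system *)

Section cas.
Variables (R : realType) (b : R).
Hypothesis b_gt0 : 0 < b.
Local Notation mu := (@lebesgue_measure R).
Local Notation ang := (gabor_angle b).

(* Hartley's functions: one real orthogonal family indexed by the integers, closed under product
   up to linear combinations, in place of separate cosines and sines. *)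
Definition cas (n : int) (t : R) : R := cos (ang n t) + sin (ang n t).

Lemma gabor_angleD n m t : ang (n + m) t = ang n t + ang m t.
Proof. by rewrite /gabor_angle rmorphD/=; ring. Qed.

Lemma gabor_angleN n t : ang (- n) t = - ang n t.
Proof. by rewrite /gabor_angle rmorphN/=; ring. Qed.

Lemma gabor_angle0 t : ang 0 t = 0.
Proof. by rewrite /gabor_angle mulr0 !mul0r. Qed.

Lemma gabor_angle_addb n t : ang n (t + b) = ang n t + n%:~R * (pi *+ 2).
Proof. by rewrite /gabor_angle -mulr_natl; field; rewrite gt_eqF. Qed.

Lemma cos_add2pi_int (n : int) (x : R) : cos (x + n%:~R * (pi *+ 2)) = cos x.
Proof.
case: n => n.
  by rewrite -pmulrn mulr_natl (periodicn (@cosD2pi R)).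
rewrite NegzE rmorphN/= mulNr -pmulrn mulr_natl.
by rewrite -(periodicn (@cosD2pi R) n.+1 (x - _)) subrK.
Qed.

Lemma sin_add2pi_int (n : int) (x : R) : sin (x + n%:~R * (pi *+ 2)) = sin x.
Proof.
case: n => n.
  by rewrite -pmulrn mulr_natl (periodicn (@sinD2pi R)).
rewrite NegzE rmorphN/= mulNr -pmulrn mulr_natl.
by rewrite -(periodicn (@sinD2pi R) n.+1 (x - _)) subrK.
Qed.

Lemma cos_gabor_angle_addb n t : cos (ang n (t + b)) = cos (ang n t).
Proof. by rewrite gabor_angle_addb cos_add2pi_int. Qed.

Lemma sin_gabor_angle_addb n t : sin (ang n (t + b)) = sin (ang n t).
Proof. by rewrite gabor_angle_addb sin_add2pi_int. Qed.

Lemma cos_gabor_angle_addbn n t i : cos (ang n (t + i%:R * b)) = cos (ang n t).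
Proof.
elim: i => [|i ih]; first by rewrite mul0r addr0.
by rewrite -natr1 mulrDl mul1r addrA cos_gabor_angle_addb.
Qed.

Lemma sin_gabor_angle_addbn n t i : sin (ang n (t + i%:R * b)) = sin (ang n t).
Proof.
elim: i => [|i ih]; first by rewrite mul0r addr0.
by rewrite -natr1 mulrDl mul1r addrA sin_gabor_angle_addb.
Qed.

Lemma is_derive_gabor_angle n (x : R) : is_derive x 1 (ang n : R -> R) (2 * pi * n%:~R / b).
Proof.
have -> : ang n = ((2 * pi * n%:~R / b) *: @idfun R).
  by apply/funext => t; rewrite -[RHS]/((2 * pi * n%:~R / b) * t) /gabor_angle; ring.
by apply: is_derive_eq; rewrite /GRing.scale/= mulr1.
Qed.

Lemma continuous_gabor_angle n : continuous (ang n).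
Proof.
move=> x; apply/differentiable_continuous/derivable1_diffP.
by have [] := is_derive_gabor_angle n x.
Qed.

Lemma continuous_cos_gabor_angle n : continuous (fun t => cos (ang n t)).
Proof.
by move=> x; apply: continuous_comp; [exact: continuous_gabor_angle|exact: continuous_cos].
Qed.

Lemma continuous_sin_gabor_angle n : continuous (fun t => sin (ang n t)).
Proof.
by move=> x; apply: continuous_comp; [exact: continuous_gabor_angle|exact: continuous_sin].
Qed.

Lemma measurable_cos_gabor_angle n : measurable_fun setT (fun t => cos (ang n t)).
Proof. by apply: continuous_measurable_fun; exact: continuous_cos_gabor_angle. Qed.

Lemma measurable_sin_gabor_angle n : measurable_fun setT (fun t => sin (ang n t)).
Proof. by apply: continuous_measurable_fun; exact: continuous_sin_gabor_angle. Qed.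

Lemma measurable_cas n : measurable_fun setT (cas n).
Proof.
by apply: measurable_funD; [exact: measurable_cos_gabor_angle|
  exact: measurable_sin_gabor_angle].
Qed.

Lemma cas0 t : cas 0 t = 1.
Proof. by rewrite /cas gabor_angle0 cos0 sin0 addr0. Qed.

Lemma casM n m t : cas n t * cas m t =
  cos (ang (n - m) t) + sin (ang (n + m) t).
Proof. by rewrite /cas !gabor_angleD gabor_angleN cosB sinD; ring. Qed.

Lemma cos_cas n t : cos (ang n t) = 2^-1 * (cas n t + cas (- n) t).
Proof. by rewrite /cas gabor_angleN cosN sinN; field. Qed.

Lemma sin_cas n t : sin (ang n t) = 2^-1 * (cas n t - cas (- n) t).
Proof. by rewrite /cas gabor_angleN cosN sinN; field. Qed.

Lemma cas_le2 n t : `|cas n t| <= 2.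
Proof.
apply: le_trans (ler_normD _ _) _.
by have := cos_max (ang n t); have := sin_max (ang n t); lra.
Qed.

Section period.
Variable al : R.
Local Notation I := (`[al, al + b[%classic : set R).

Lemma measure_period : mu I = b%:E.
Proof. by rewrite lebesgue_measure_itv/= lte_fin ltrDl b_gt0 -EFinB addrC addKr. Qed.

Lemma period_lty : (mu I < +oo)%E.
Proof. by rewrite measure_period ltry. Qed.

Let int_derive_period (f F : R -> R) : continuous f ->
  (forall x : R, is_derive x 1 F (f x)) -> F (al + b) = F al -> Rintegral mu I f = 0.
Proof.
move=> cf dF Fb; rewrite /Rintegral integral_itv_bndo_bndc; last first.
  by apply/measurable_EFinP/measurable_funTS; exact: continuous_measurable_fun.
have cF : continuous F.
  move=> x; apply/differentiable_continuous/derivable1_diffP.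
  by have [] := dF x.
rewrite (@continuous_FTC2 _ f F) ?ltrDl//.
- by rewrite Fb -EFinB subrr.
- exact: continuous_subspaceT.
- split.
  + by move=> x _; have [] := dF x.
  + exact/cvg_at_right_filter/cF.
  + exact/cvg_at_left_filter/cF.
- by move=> x _; rewrite derive1E; have [_ ->] := dF x.
Qed.

Lemma int_cos_period n :
  Rintegral mu I (fun t => cos (ang n t)) = if n == 0 then b else 0.
Proof.
have [->|n0] := eqVneq n 0.
  under eq_Rintegral do rewrite gabor_angle0 cos0.
  by rewrite Rintegral_cst//= mul1r measure_period.
pose w := 2 * pi * n%:~R / b.
have w0 : w != 0.
  by rewrite /w !mulf_neq0 ?intr_eq0 ?invr_eq0 ?(gt_eqF (pi_gt0 _)) ?(gt_eqF b_gt0).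
apply: (@int_derive_period _ (fun t => w^-1 * sin (ang n t))).
- exact: continuous_cos_gabor_angle.
- move=> x; have dang := is_derive_gabor_angle n x.
  have := is_derive1_comp (is_derive_sin (ang n x)) dang.
  rewrite -/w => H.
  have -> : (fun t => w^-1 * sin (ang n t)) = w^-1 *: (sin \o ang n).
    by apply/funext => t; rewrite /GRing.scale.
  by apply: is_derive_eq; rewrite /GRing.scale/=; field.
- by rewrite sin_gabor_angle_addb.
Qed.

Lemma int_sin_period n : Rintegral mu I (fun t => sin (ang n t)) = 0.
Proof.
have [->|n0] := eqVneq n 0.
  under eq_Rintegral do rewrite gabor_angle0 sin0.
  by rewrite /Rintegral integral0.
pose w := 2 * pi * n%:~R / b.
have w0 : w != 0.
  by rewrite /w !mulf_neq0 ?intr_eq0 ?invr_eq0 ?(gt_eqF (pi_gt0 _)) ?(gt_eqF b_gt0).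
apply: (@int_derive_period _ (fun t => - w^-1 * cos (ang n t))).
- exact: continuous_sin_gabor_angle.
- move=> x; have dang := is_derive_gabor_angle n x.
  have := is_derive1_comp (is_derive_cos (ang n x)) dang.
  rewrite -/w => H.
  have -> : (fun t => - w^-1 * cos (ang n t)) = (- w^-1) *: (cos \o ang n).
    by apply/funext => t; rewrite /GRing.scale.
  by apply: is_derive_eq; rewrite /GRing.scale/=; field.
- by rewrite cos_gabor_angle_addb.
Qed.

Lemma L2on_cas n : L2on mu I (cas n).
Proof.
apply: (@L2on_bounded _ _ _ _ _ _ _ 2) => //; first exact: period_lty.
by apply: measurable_funTS; exact: measurable_cas.
by move=> x _; exact: cas_le2.
Qed.

Lemma cas_orthogonal n m : dotp mu I (cas n) (cas m) = if n == m then b else 0.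
Proof.
have bI (f : R -> R) : measurable_fun setT f -> (forall x, `|f x| <= 1) ->
    mu.-integrable I (EFin \o f).
  move=> mf f1; apply: measurable_bounded_integrable => //.
  - exact: period_lty.
  - exact: measurable_funTS.
  - exists 1; split; first exact: num_real.
    by move=> M M1 x _ /=; exact: le_trans (ltW M1).
rewrite /dotp; under eq_Rintegral do rewrite casM.
rewrite RintegralD//.
- by rewrite int_cos_period int_sin_period addr0 subr_eq0.
- by apply: bI; [exact: measurable_cos_gabor_angle|move=> x; exact: cos_max].
- by apply: bI; [exact: measurable_sin_gabor_angle|move=> x; exact: sin_max].
Qed.

End period.
End cas.

(** * Polynomials that converge to a step at 1/2 *)

Section sharp_polynomials.
Variable R : realType.

Lemma bernoulli_ge (x : R) m : 0 <= x -> 1 + m%:R * x <= (1 + x) ^+ m.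
Proof.
move=> x0; elim: m => [|m ih]; first by rewrite mul0r addr0 expr0.
rewrite exprSr -natr1; apply: (@le_trans _ _ ((1 + m%:R * x) * (1 + x))).
  by have : 0 <= m%:R :> R by []; nra.
by rewrite ler_wpM2r// addr_ge0.
Qed.

Lemma bernoulli_le (x : R) m : 0 <= x <= 1 -> 1 - m%:R * x <= (1 - x) ^+ m.
Proof.
move=> /andP[x0 x1]; elim: m => [|m ih]; first by rewrite mul0r subr0 expr0.
rewrite exprSr -natr1; apply: (@le_trans _ _ ((1 - m%:R * x) * (1 - x))).
  by have : 0 <= m%:R :> R by []; nra.
by rewrite ler_wpM2r// subr_ge0.
Qed.

(* The polynomials of the Brosowski-Deutsch proof of the Stone-Weierstrass theorem. *)
Definition sharp (n : nat) (s : R) := (1 - s ^+ n) ^+ (2 ^ n).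

Lemma sharp_itv n s : 0 <= s <= 1 -> 0 <= sharp n s <= 1.
Proof.
move=> /andP[s0 s1]; rewrite /sharp; have sn : 0 <= s ^+ n <= 1.
  by rewrite exprn_ge0//= exprn_ile1.
by rewrite exprn_ge0 ?exprn_ile1//; lra.
Qed.

(** Bernoulli's inequality bounds the value below by 1 - (2 s)^n; the exponent 2^n is what puts the
    threshold at 1/2. *)
Lemma sharp_cvg1 s : 0 <= s < 2^-1 -> sharp ^~ s @ \oo --> (1 : R).
Proof.
move=> /andP[s0 s1].
apply: (@squeeze_cvgr _ _ _ R (fun n => 1 - (2 * s) ^+ n) (fun=> 1)).
- apply: nearW => n; have /andP[_ ->] : 0 <= sharp n s <= 1 by apply: sharp_itv; lra.
  rewrite andbT exprMn -natrX; apply: bernoulli_le.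
  by rewrite exprn_ge0//= exprn_ile1//; lra.
- rewrite -[X in _ --> X]subr0; apply: cvgB; first exact: cvg_cst.
  by apply: cvg_expr; rewrite ger0_norm; lra.
- exact: cvg_cst.
Qed.

(** The product of (1 - s^n)^(2^n) and (1 + s^n)^(2^n) is at most 1, and the second factor is at
    least (2 s)^n by Bernoulli's inequality. *)
Lemma sharp_cvg0 s : 2^-1 < s <= 1 -> sharp ^~ s @ \oo --> (0 : R).
Proof.
move=> /andP[s0 s1].
apply: (@squeeze_cvgr _ _ _ R (fun=> 0) (fun n => (2 * s)^-1 ^+ n)).
- apply: nearW => n; have /andP[-> _]/= : 0 <= sharp n s <= 1 by apply: sharp_itv; lra.
  have sn : 0 <= s ^+ n <= 1 by rewrite exprn_ge0 ?exprn_ile1//; lra.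
  have s2 : 0 < (2 * s) ^+ n by rewrite exprn_gt0//; lra.
  rewrite exprVn -[leRHS]mul1r ler_pdivlMr//.
  apply: (@le_trans _ _ (sharp n s * (1 + s ^+ n) ^+ (2 ^ n))).
    apply: ler_wpM2l; first by apply: exprn_ge0; lra.
    apply: le_trans (bernoulli_ge _ _); last lra.
    by rewrite exprMn natrX; lra.
  rewrite /sharp -exprMn; apply: exprn_ile1; nra.
- exact: cvg_cst.
- by apply: cvg_expr; rewrite ger0_norm ?invr_ge0 ?invf_lt1; lra.
Qed.

End sharp_polynomials.

(** * Approximation of step functions by trigonometric polynomials *)

Section density.
Variables (R : realType) (b al : R).
Hypothesis b_gt0 : 0 < b.
Local Notation mu := (@lebesgue_measure R).
Local Notation I := (`[al, al + b[%classic : set R).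
Local Notation sp := (spanned (@cas R b)).
Local Notation appr := (approximable mu I (@cas R b)).

Let mI : measurable (I : set (measurableTypeR R)). Proof. exact: measurable_itv. Qed.
Let Lcas := L2on_cas b_gt0 al.

Lemma spanned_cos n : sp (fun t => cos (gabor_angle b n t)).
Proof.
under eq_fun do rewrite cos_cas.
by apply: spannedZ; apply: spannedD; exact: spanned_e.
Qed.

Lemma spanned_sin n : sp (fun t => sin (gabor_angle b n t)).
Proof.
under eq_fun do rewrite sin_cas -mulN1r.
by apply: spannedZ; apply: spannedD; [|apply: spannedZ]; exact: spanned_e.
Qed.

Lemma spanned_cst c : sp (fun=> c).
Proof.
rewrite (_ : (fun=> c) = (fun t => c * cas b 0 t)).
  by apply: spannedZ; exact: spanned_e.
by apply/funext => t; rewrite cas0 mulr1.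
Qed.

Lemma spannedM p q : sp p -> sp q -> sp (fun t => p t * q t).
Proof.
move=> [X [c1 [_ ->]]] [Y [c2 [_ ->]]]; rewrite /comb.
under eq_fun do rewrite mulr_suml.
apply: spanned_sum => n; under eq_fun do rewrite mulr_sumr.
apply: spanned_sum => m.
rewrite (_ : (fun t => _) = (fun t => (c1 n * c2 m) *
    (cos (gabor_angle b (n - m) t) + sin (gabor_angle b (n + m) t)))).
  by apply: spannedZ; apply: spannedD; [exact: spanned_cos|exact: spanned_sin].
by apply/funext => t; rewrite -casM; ring.
Qed.

Lemma spannedX p m : sp p -> sp (fun t => p t ^+ m).
Proof.
move=> hp; elim: m => [|m ih]; first by under eq_fun do rewrite expr0; exact: spanned_cst.
by under eq_fun do rewrite exprS; exact: spannedM.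
Qed.

Lemma spanned_sharp p n : sp p -> sp (fun t => sharp n (p t)).
Proof.
move=> hp; apply: spannedX.
under eq_fun do rewrite -[- _]mulN1r.
by apply: spannedD; [exact: spanned_cst|apply: spannedZ; exact: spannedX].
Qed.

(* On the period this trigonometric polynomial lies in [0, 1], and it is below 1/2 exactly before y. *)
Definition cut (y t : R) : R :=
  2^-1 - 2^-1 * (sin (pi / b * (t - al)) * sin (pi / b * (y - t))).

(** Each sine factor has half the basic frequency and is not [b]-periodic. In their product the sum
    of the two arguments is constant in [t] and their difference has the basic frequency, so only a
    constant and waves of index 1 remain. *)
Lemma spanned_cut y : sp (cut y).
Proof.
pose t0 := pi / b * (al + y).
rewrite (_ : cut y = fun t => (2^-1 + 4^-1 * cos (pi / b * (y - al))) +
   (- 4^-1 * (cos t0 * cos (gabor_angle b 1 t) + sin t0 * sin (gabor_angle b 1 t)))).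
  apply: spannedD; first exact: spanned_cst.
  apply: spannedZ; apply: spannedD; apply: spannedZ; [exact: spanned_cos|exact: spanned_sin].
apply/funext => t; rewrite -cosB /cut.
have -> : t0 - gabor_angle b 1 t = pi / b * (y - t) - pi / b * (t - al).
  by rewrite /t0 /gabor_angle; field; rewrite gt_eqF.
have -> : pi / b * (y - al) = pi / b * (y - t) + pi / b * (t - al).
  by field; rewrite gt_eqF.
by rewrite cosB cosD; field.
Qed.

Lemma cut_itv y t : 0 <= cut y t <= 1.
Proof.
have : `|sin (pi / b * (t - al)) * sin (pi / b * (y - t))| <= 1.
  by rewrite normrM mulr_ile1 ?sin_max.
by rewrite /cut ler_norml => /andP[]; lra.
Qed.

Let pb_gt0 : 0 < pi / b. Proof. by rewrite divr_gt0// pi_gt0. Qed.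

Let pib_lt x : x < b -> pi / b * x < pi.
Proof.
move=> xb; have e : pi / b * b = pi :> R by field; rewrite gt_eqF.
by rewrite -[ltRHS]e ltr_pM2l.
Qed.

Lemma cut_lt y t : y <= al + b -> al < t < y -> cut y t < 2^-1.
Proof.
move=> yb /andP[at_ ty]; rewrite /cut.
have s1 : 0 < sin (pi / b * (t - al)).
  by apply: sin_gt0_pi; rewrite mulr_gt0 ?subr_gt0//= pib_lt//; lra.
have s2 : 0 < sin (pi / b * (y - t)).
  by apply: sin_gt0_pi; rewrite mulr_gt0 ?subr_gt0//= pib_lt//; lra.
by have := mulr_gt0 s1 s2; lra.
Qed.

Lemma cut_gt y t : al < y -> y < t < al + b -> 2^-1 < cut y t.
Proof.
move=> ay /andP[yt tb]; rewrite /cut.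
have s1 : 0 < sin (pi / b * (t - al)).
  by apply: sin_gt0_pi; rewrite mulr_gt0 ?subr_gt0//= ?pib_lt//; lra.
have s2 : 0 < sin (pi / b * (t - y)).
  by apply: sin_gt0_pi; rewrite mulr_gt0 ?subr_gt0//= pib_lt//; lra.
have -> : pi / b * (y - t) = - (pi / b * (t - y)) by ring.
by rewrite sinN; have := mulr_gt0 s1 s2; lra.
Qed.

Lemma approximable_cst c : appr (fun=> c).
Proof. by apply: approximable_spanned => //; exact: spanned_cst. Qed.

Let L2on1 : L2on mu I (fun=> 1).
Proof.
apply: (@L2on_bounded _ _ _ _ _ _ _ 1) => //; first exact: period_lty.
by move=> x _; rewrite normr1.
Qed.

(** Composing [sharp n] with [cut y] gives trigonometric polynomials that tend to 1 before [y] and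
    to 0 after it, boundedly, hence in L2. *)
Lemma approximable_step y : al < y <= al + b -> appr (\1_(`]-oo, y[%classic : set R)).
Proof.
move=> /andP[ay yb].
have mS : measurable_fun I (\1_(`]-oo, y[%classic : set R) : R -> R).
  by apply: measurable_indic; exact: measurable_itv.
have LS : L2on mu I (\1_(`]-oo, y[%classic : set R)).
  apply: (@L2on_bounded _ _ _ _ _ _ _ 1) => //; first exact: period_lty.
  move=> x _.
  by rewrite indicE; case: (_ \in _); rewrite ?normr1 ?normr0.
apply: approximable_closed => // eps e0.
have Ls n := L2on_spanned mI Lcas (spanned_sharp n (spanned_cut y)).
have [] := @dominated_L2 _ _ _ mu I mI
  (fun n t => \1_(`]-oo, y[%classic : set R) t - sharp n (cut y t)) (fun=> 1) _ L2on1 _ _ eps e0.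
- by move=> n; apply: measurable_funB => //; exact: (Ls n).1.
- move=> n x _; rewrite normr1 indicE.
  have := sharp_itv n (cut_itv y x) => /andP[? ?].
  by rewrite ler_norml; case: (_ \in _) => /=; lra.
(* At these two points [cut y] equals 1/2, where the limit of [sharp] is not known; they form a null
   set. *)
- exists [set al; y]; split.
  + exact: measurableU.
  + by apply: countable_lebesgue_measure0; exact/finite_set_countable/finite_set2.
  + move=> t /=; apply: contra_notP => /not_orP[tal ty]; rewrite in_itv/= => /andP[alt tb].
    have {}alt : al < t by rewrite lt_neqAle alt andbT; apply/eqP => /esym.
    rewrite indicE mem_setE in_itv/=.
    have [tly|] := ltP t y; last rewrite le_eqVlt => /orP[/eqP/esym//|ylt].
      rewrite -[X in _ --> X](subrr 1); apply: cvgB; first exact: cvg_cst.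
      by apply: sharp_cvg1; have /andP[-> _] := cut_itv y t; rewrite cut_lt ?alt.
    rewrite -[X in _ --> X](subrr 0); apply: cvgB; first exact: cvg_cst.
    by apply: sharp_cvg0; have /andP[_ ->] := cut_itv y t; rewrite andbT cut_gt ?ylt.
- move=> n [_ H]; exists (fun t => sharp n (cut y t)); split => //.
  exact/approximable_spanned/spanned_sharp/spanned_cut.
Qed.

End density.

(** * Completeness of the trigonometric system on a period *)

Section completeness.
Variables (R : realType) (b al : R).
Hypothesis b_gt0 : 0 < b.
Local Notation mu := (@lebesgue_measure R).
Local Notation T := (measurableTypeR R).
Local Notation I := (`[al, al + b[%classic : set T).
Local Notation appr := (approximable mu I (@cas R b)).

Let mI : measurable I. Proof. exact: measurable_itv. Qed.
Let Lcas := L2on_cas b_gt0 al.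

Let L2on_indic (A : set T) : measurable A -> L2on mu I (\1_A : T -> R).
Proof.
move=> mA; apply: (@L2on_bounded _ _ _ _ _ _ _ 1) => //; first exact: period_lty.
by move=> x _; rewrite indicE; case: (_ \in _); rewrite ?normr1 ?normr0.
Qed.

(** Rays form a class stable under intersection that generates the Borel sets, and the sets with
    approximable indicator form a Dynkin class: complements use the constant 1, countable disjoint
    unions use dominated convergence of the partial sums. *)
Lemma approximable_indic (A : set T) : measurable A -> appr (\1_A : T -> R).
Proof.
move=> mA; suff H : forall S : set T, <<s @RGenInftyO.G R >> S -> appr (\1_S : T -> R).
  by apply: H; move: mA; rewrite (@RGenInftyO.measurableE R).
apply: (@dynkin_induction _ T (@RGenInftyO.G R) (fun A => appr (\1_A : T -> R))).
- exact: (@RGenInftyO.measurableE R).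
- move=> _ _ [x ->] [y ->]; exists (Num.min x y).
  apply/seteqP; split => t /=; rewrite !in_itv/= lt_min; first by move=> [-> ->].
  by move=> /andP[].
- by rewrite indicT; exact: approximable_cst.
- move=> _ [y ->].
  have [yal|aly] := leP y al.
    apply: (@eq_approximable _ _ _ _ _ mI _ _ Lcas (fun=> 0)); last exact: approximable_cst.
    move=> x; rewrite inE/= in_itv/= indicE mem_setE in_itv/= => /andP[ax _].
    by rewrite ltNge (le_trans yal).
  have [yb|by_] := leP y (al + b); first by apply: approximable_step => //; rewrite aly.
  apply: (@eq_approximable _ _ _ _ _ mI _ _ Lcas (fun=> 1)); last exact: approximable_cst.
  move=> x; rewrite inE/= in_itv/= indicE mem_setE in_itv/= => /andP[_ xb].
  by rewrite (lt_trans xb).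
- move=> S mS aS; rewrite (_ : \1_(~` S) = fun x => 1 + -1 * \1_S x).
    by apply: approximableD => //; [exact: approximable_cst|exact: approximableZ].
  by apply/funext => x; rewrite !indicE in_setC; case: (_ \in _) => /=; ring.
- move=> F mF tF aF.
  have mU : measurable (\bigcup_k F k) by exact: bigcup_measurable.
  apply: (approximable_closed mI Lcas (L2on_indic mU)) => eps e0.
  have pF x k : x \in F k -> forall i, (x \in F i) = (i == k).
    rewrite inE => Fk i; apply/idP/eqP => [|->]; last by rewrite inE.
    rewrite inE => Fi; apply: contrapT => ik.
    have /trivIsetP/(_ i k Logic.I Logic.I) := tF; move/eqP: ik => ik /(_ ik) H.
    by have : (F i `&` F k) x by []; rewrite H.
  have ps n x k : x \in F k -> \sum_(i < n) \1_(F i) x = (k < n)%:R :> R.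
    move=> xk; under eq_bigr do rewrite indicE (pF _ _ xk).
    have [kn|nk] := ltnP k n.
      rewrite (bigD1 (Ordinal kn))//= eqxx big1 ?addr0// => i ik.
      by case: eqP => // e; case/eqP: ik; apply/val_inj.
    by rewrite big1// => i _; rewrite ltn_eqF// (leq_trans (ltn_ord i)).
  have p0 n x : x \notin \bigcup_k F k -> \sum_(i < n) \1_(F i) x = 0 :> R.
    move=> xU; rewrite big1// => i _; rewrite indicE.
    case: (boolP (x \in F i)) => //; rewrite inE => xi.
    by case/negP: xU; rewrite inE; exists i.
  have [] := @dominated_L2 _ _ _ mu I mI
    (fun n x => \1_(\bigcup_k F k) x - \sum_(i < n) \1_(F i) x) (fun=> 1) _ _ _ _ eps e0.
  + move=> n; apply: measurable_funB; first exact: measurable_indic.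
    by apply: measurable_sum => i; exact: measurable_indic.
  + have := L2on_indic (@measurableT _ T); by rewrite indicT.
  + move=> n x _; rewrite normr1 indicE.
    have [xU|/p0 ->] := boolP (x \in \bigcup_k F k); last by rewrite subr0 normr0.
    have [k _ xk] : (\bigcup_k F k) x by rewrite -inE.
    rewrite (ps n _ k) ?inE//; case: (k < n)%N => /=; rewrite ?subrr ?subr0 ?normr0 ?normr1//.
  + apply: aeW => x _.
    have [xU|xU] := boolP (x \in \bigcup_k F k); last first.
      under eq_fun do rewrite p0// subr0 indicE (negbTE xU).
      exact: cvg_cst.
    have [k _ xk] : (\bigcup_k F k) x by rewrite -inE.
    apply: cvg_near_cst; exists k.+1 => // n /= kn.
    by rewrite (ps n _ k) ?inE// kn indicE xU subrr.
  + move=> n [_ H]; exists (fun x => \sum_(i < n) \1_(F i) x); split => //.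
    exact: approximable_sum.
Qed.

Import HBNNSimple.

Lemma approximable_nnsfun (f : {nnsfun T >-> R}) : appr (f : T -> R).
Proof.
rewrite (_ : (f : T -> R) = fun x => \sum_(y <- finmap.enum_fset (fset_set (range f))) y * \1_(f @^-1` [set y]) x).
  apply: approximable_sum => // y; apply: approximableZ => //.
  by apply: approximable_indic.
apply/funext => x; rewrite {1}fimfunE fsbig_finite//.
Qed.

Lemma approximable_ge0 (f : T -> R) : L2on mu I f -> (forall x, 0 <= f x) -> appr f.
Proof.
move=> Lf f0; apply: (approximable_closed mI Lcas Lf) => eps e0.
have mf : measurable_fun I (EFin \o f) by apply/measurable_EFinP; exact: Lf.1.
pose h := nnsfun_approx mI mf.
have hcv x : I x -> h ^~ x @ \oo --> f x.
  move=> Ix; have := @cvg_nnsfun_approx _ _ _ _ mI _ mf _ x Ix.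
  have H : forall x, I x -> (0 <= (EFin \o f) x)%E by move=> y _; rewrite lee_fin.
  by move=> /(_ H)/fine_cvg.
have hle n x : I x -> h n x <= f x.
  move=> Ix; rewrite -(cvg_lim _ (hcv x Ix))//.
  apply: nondecreasing_cvgn_le; last by apply/cvg_ex; exists (f x); exact: hcv.
  by move=> p q pq; exact/lefP/(nd_nnsfun_approx mI mf).
have [] := @dominated_L2 _ _ _ mu I mI (fun n x => f x - h n x) f _ Lf _ _ eps e0.
- move=> n; apply: measurable_funB; first exact: Lf.1.
  by apply: measurable_funTS.
- move=> n x Ix; have := hle n x Ix; have : 0 <= h n x by [].
  by move=> ? ?; rewrite !ger0_norm; lra.
- apply: aeW => x Ix; rewrite -[X in _ --> X](subrr (f x)).
  by apply: cvgB; [exact: cvg_cst|exact: hcv].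
- by move=> n [_ H]; exists (h n); split => //; exact: approximable_nnsfun.
Qed.

Lemma approximable_L2 (f : T -> R) : L2on mu I f -> appr f.
Proof.
move=> Lf.
have Lb (g : T -> R) : measurable_fun I g -> (forall x, `|g x| <= `|f x|) -> L2on mu I g.
  move=> mg gf; split => //; apply: (le_integrable mI _ _ Lf.2).
    by apply/measurable_EFinP/measurable_funX.
  move=> x _; rewrite /= lee_fin !normrX lerXn2r ?nnegrE//.
rewrite (_ : f = fun x => Num.max (f x) 0 + -1 * Num.max (- f x) 0); last first.
  by apply/funext => x; rewrite !maxEle; case: ifP; case: ifP; lra.
apply: approximableD => //; last apply: approximableZ => //; apply: approximable_ge0.
- apply: Lb; first by apply: measurable_maxr => //; exact: Lf.1.
  by move=> x; rewrite maxEle; case: ifP; rewrite ?normr0.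
- by move=> x; rewrite le_max lexx orbT.
- apply: Lb; first by apply: measurable_maxr => //; apply: measurableT_comp => //; exact: Lf.1.
  by move=> x; rewrite maxEle; case: ifP; rewrite ?normr0 ?normrN.
- by move=> x; rewrite le_max lexx orbT.
Qed.

Theorem parseval_cas (g : T -> R) : L2on mu I g ->
  (\esum_(n in [set: int]) (dotp mu I g (cas b n) ^+ 2)%:E = (b * dotp mu I g g)%:E)%E.
Proof.
move=> Lg; apply: parseval_identity => //; last exact: approximable_L2.
exact: cas_orthogonal.
Qed.

End completeness.

(** * Translation and tiling of Lebesgue integrals *)

Section translation.
Context {R : realType}.
Local Notation mu := (@lebesgue_measure R).
Local Notation T := (measurableTypeR R).

Lemma measurable_shift (h : R) : measurable_fun [set: T] (fun x : T => (x + h)%R : T).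
Proof. by apply: measurable_funD => //; exact: measurable_cst. Qed.

(** By uniqueness of Lebesgue measure it is enough to compare the two measures on half-open
    intervals. *)
Lemma lebesgue_measure_shift (h : R) (A : set T) : measurable A ->
  pushforward mu (fun x : T => (x + h)%R : T) A = mu A.
Proof.
pose mx := isMeasurableFun.Build _ _ _ _ _ (measurable_shift h).
pose s : {mfun T >-> T} := HB.pack (fun x : T => (x + h)%R : T) mx.
move=> mA; apply/esym/(@lebesgue_measure_unique _ (pushforward mu s)) => //= _ [[x y]] _ <-.
rewrite /pushforward/= (_ : _ @^-1` _ = `]x - h, y - h]%classic); last first.
  by apply/seteqP; split => t /=; rewrite !in_itv/= ltrBlDr lerBrDr.
rewrite !lebesgue_measure_itv/= !lte_fin ltrD2r; case: ifP => // _.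
by rewrite -!EFinB; congr EFin; ring.
Qed.

Lemma ge0_integral_shift (h : R) (D : set T) (f : T -> \bar R) :
  measurable D -> measurable_fun D f -> (forall x, D x -> (0 <= f x)%E) ->
  (\int[mu]_(x in D) f x = \int[mu]_(x in (fun x => (x + h)%R) @^-1` D) f (x + h)%R)%E.
Proof.
move=> mD mf f0.
rewrite -(@ge0_integral_pushforward _ _ _ _ _ _ (measurable_shift h) mu D f)//; last first.
  by move=> x; rewrite inE; exact: f0.
apply: eq_measure_integral; first exact: measurable_shift.
by move=> ? A mA AD; apply/esym; exact: lebesgue_measure_shift.
Qed.

Lemma integral_shift (h : R) (D : set T) (f : T -> \bar R) :
  measurable D -> measurable_fun D f ->
  (\int[mu]_(x in D) f x = \int[mu]_(x in (fun x => (x + h)%R) @^-1` D) f (x + h)%R)%E.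
Proof.
move=> mD mf; rewrite integralE [RHS]integralE; congr (_ - _)%E.
- rewrite (ge0_integral_shift h mD (measurable_funepos mf))//.
  by apply: eq_integral => x _; rewrite !funeposE.
- rewrite (ge0_integral_shift h mD (measurable_funeneg mf))//.
  by apply: eq_integral => x _; rewrite !funenegE.
Qed.

Lemma Rintegral_shift_itv (h x y : R) (f : T -> R) : measurable_fun [set: T] f ->
  Rintegral mu `[x + h, y + h[%classic f = Rintegral mu `[x, y[%classic (fun t => f (t + h)).
Proof.
move=> mf; rewrite /Rintegral (integral_shift h)//; last first.
  by apply/measurable_EFinP; exact: measurable_funTS.
congr fine; congr integral; apply/seteqP; split => t /=; rewrite !in_itv/=.
  by rewrite lerD2r ltrD2r.
by rewrite lerD2r ltrD2r.
Qed.

Lemma ge0_integral_shift_itv (h x y : R) (f : T -> \bar R) : measurable_fun [set: T] f ->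
  (forall t, (0 <= f t)%E) ->
  (\int[mu]_(t in `[(x + h)%R, (y + h)%R[%classic) f t = \int[mu]_(t in `[x, y[%classic) f (t + h)%R)%E.
Proof.
move=> mf f0; rewrite (ge0_integral_shift h)//; last exact: measurable_funTS.
congr integral; apply/seteqP; split => t /=; rewrite !in_itv/= lerD2r ltrD2r//.
Qed.

Lemma ge0_integral_shiftT (h : R) (f : T -> \bar R) : measurable_fun [set: T] f ->
  (forall t, (0 <= f t)%E) -> (\int[mu]_t f (t + h)%R = \int[mu]_t f t)%E.
Proof. by move=> mf f0; rewrite [RHS](ge0_integral_shift h)// preimage_setT. Qed.

Lemma measurable_comp_shift (h : R) (f : T -> R) : measurable_fun [set: T] f ->
  measurable_fun [set: T] (fun t => f (t + h)).
Proof. by move=> mf; apply: measurableT_comp => //; exact: measurable_shift. Qed.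

Lemma integrable_shiftT (h : R) (f : T -> R) : mu.-integrable [set: T] (EFin \o f) ->
  mu.-integrable [set: T] (EFin \o (fun t => f (t + h))).
Proof.
move=> /integrableP[/measurable_EFinP mf fi]; apply/integrableP; split.
  by apply/measurable_EFinP; exact: measurable_comp_shift.
rewrite (@ge0_integral_shiftT h (fun t => `|(f t)%:E|%E))//.
by apply: measurableT_comp => //; exact/measurable_EFinP.
Qed.

(** This folding is what produces window sums: a Gabor atom is a [b]-periodic wave cut off to a
    bounded interval, so its inner product with [f] becomes a Fourier coefficient of a folded
    function on one period. *)
Lemma Rintegral_periodize (al b : R) (n : nat) (G : T -> R) : 0 < b ->
  mu.-integrable [set: T] (EFin \o G) ->
  (forall x, G x != 0 -> al <= x < al + n%:R * b) ->
  Rintegral mu [set: T] G =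
  Rintegral mu `[al, al + b[%classic (fun x => \sum_(i < n) G (x + i%:R * b)).
Proof.
move=> b0 iG G0; have mG : measurable_fun [set: T] G.
  by apply/measurable_EFinP; case/integrableP : iG.
have iGs i D : measurable D -> mu.-integrable D (EFin \o (fun x => G (x + i * b))).
  by move=> mD; apply: integrableS (integrable_shiftT _ iG).
have iGD D : measurable D -> mu.-integrable D (EFin \o G).
  by move=> mD; apply: integrableS iG.
transitivity (Rintegral mu `[al, al + n%:R * b[%classic G).
  rewrite [RHS]Rintegral_mkcond; apply: eq_Rintegral => x _; rewrite patchE.
  case: ifPn => // xI; apply/eqP/negPn/negP => /G0 H; case/negP: xI.
  by rewrite mem_setE in_itv.
elim: n {G0} => [|n ih].
  rewrite mul0r addr0 set_itvco0 Rintegral_set0; under eq_Rintegral do rewrite big_ord0.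
  by rewrite /Rintegral integral0.
transitivity (Rintegral mu `[al, al + b[%classic (fun x => \sum_(i < n) G (x + i%:R * b))
   + Rintegral mu `[al, al + b[%classic (fun x => G (x + n%:R * b))).
  rewrite -ih -Rintegral_shift_itv// -Rintegral_setU//.
  - congr (Rintegral mu _ G); rewrite -[al + b + _]addrA -[b + _]addrC.
    rewrite -[X in n%:R * b + X]mul1r -mulrDl natr1.
    apply/seteqP; split => t /=; rewrite !in_itv/=.
      by case: (ltP t (al + n%:R * b)) => H /andP[-> ->]; [left|right].
    move=> [/andP[-> H]|/andP[H ->]] /=.
      by apply: (lt_le_trans H); rewrite lerD2l ler_pM2r// ler_nat.
    by rewrite andbT; apply: le_trans H; rewrite lerDl mulr_ge0// ltW.
  - by apply: iGD; apply: measurableU.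
  - apply/disj_setPS => t [/=]; rewrite !in_itv/= => /andP[_ t1] /andP[t2 _].
    by have := lt_le_trans t1 t2; rewrite ltxx.
rewrite -RintegralD//; last exact: iGs.
  by apply: eq_Rintegral => x _; rewrite big_ord_recr.
rewrite (_ : _ \o _ = fun x => (\sum_(i < n) (EFin \o (fun x => (G (x + i%:R * b))%R)) x)%E).
  by apply: integrable_sum => // i _; exact: iGs.
by apply/funext => x /=; rewrite sumEFin.
Qed.

End translation.

Section tiling.
Context d (T : measurableType d) (R : realType) (mu : {measure set T -> \bar R}).

Lemma ge0_integral_esum_bigcup (K : countType) (F : K -> set T) (f : T -> \bar R) :
  (forall k, measurable (F k)) -> trivIset [set: K] F ->
  measurable_fun (\bigcup_k F k) f -> (forall x, (0 <= f x)%E) ->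
  (\int[mu]_(x in \bigcup_k F k) f x = \esum_(k in [set: K]) \int[mu]_(x in F k) f x)%E.
Proof.
move=> mF tF mf f0.
(* Countable additivity is indexed by natural numbers; codes that name no element of [K] receive the
   empty set. *)
pose G n := if pickle_inv n is Some k then F k else set0.
have UE : \bigcup_k F k = \bigcup_n G n.
  apply/seteqP; split => x [k _ xk].
    by exists (pickle k) => //; rewrite /G pickleK_inv.
  by move: xk; rewrite /G; case: pickle_inv => // j xj; exists j.
have tG : trivIset [set: nat] G.
  apply/trivIsetP => i j _ _ ij; rewrite /G.
  case Ei : (pickle_inv i) => [k|]; last by rewrite set0I.
  case Ej : (pickle_inv j) => [l|]; last by rewrite setI0.
  move/trivIsetP : tF; apply => //; apply: contra_neq ij => kl.
  have := @pickle_invK K i; have := @pickle_invK K j.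
  by rewrite Ei Ej /= kl => -> ->.
rewrite UE ge0_integral_bigcup//; last first.
- by rewrite -UE.
- by move=> n; rewrite /G; case: pickle_inv.
rewrite nneseries_esumT; last by move=> n; exact: integral_ge0.
transitivity (\esum_(n in range (@pickle K)) \int[mu]_(x in G n) f x)%E.
  rewrite [RHS]esum_mkcond; apply: eq_esum => n _; case: ifPn => //.
  rewrite /G; case E : (pickle_inv n) => [k|]; last by rewrite integral_set0.
  move=> /negP; case; rewrite inE; exists k => //.
  by have := @pickle_invK K n; rewrite E.
rewrite (@reindex_esum _ _ _ [set: K] (range pickle) pickle).
  by apply: eq_esum => k _; rewrite /G pickleK_inv.
by split => // x y _ _; exact: (pcan_inj pickleK_inv).
Qed.

End tiling.

Section real_tiling.
Context {R : realType}.
Local Notation mu := (@lebesgue_measure R).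
Local Notation T := (measurableTypeR R).
Variable a : R.
Hypothesis a_gt0 : 0 < a.

(** The spacing is [a] while the length is free: length [a] gives a partition of the line, length
    [b] the overlapping periods on which Parseval is applied. *)
Definition tile (l : R) (m : int) : set T := `[m%:~R * a, m%:~R * a + l[%classic.

Lemma tile_floor x m : tile a m x -> Num.floor (x / a) = m.
Proof.
rewrite /tile/= in_itv/= => /andP[mx xm]; apply/floor_def.
by rewrite ler_pdivlMr// mx ltr_pdivrMr// rmorphD/= mulrDl mul1r.
Qed.

Lemma floor_tile x : tile a (Num.floor (x / a)) x.
Proof.
have /andP[H1 H2] := floor_itv (x / a); rewrite /tile/= in_itv/=.
by move: H1 H2; rewrite ler_pdivlMr// ltr_pdivrMr// rmorphD/= mulrDl mul1r => -> ->.
Qed.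

Lemma integral_tile (f : T -> \bar R) : measurable_fun [set: T] f ->
  (forall x, (0 <= f x)%E) ->
  (\int[mu]_x f x = \esum_(m in [set: int]) \int[mu]_(x in tile a m) f x)%E.
Proof.
move=> mf f0; have -> : [set: T] = \bigcup_(m : int) tile a m.
  by apply/seteqP; split => // x _; exists (Num.floor (x / a)) => //; exact: floor_tile.
rewrite ge0_integral_esum_bigcup//.
- by move=> m; exact: measurable_itv.
- apply/trivIsetP => i j _ _; apply: contra_neqP => /eqP/set0P[x [xi xj]].
  by rewrite -(tile_floor xi) (tile_floor xj).
- exact: measurable_funTS.
Qed.

Lemma esum_shift_int (u : int -> \bar R) :
  (\esum_(m in [set: int]) u (m + 1)%R = \esum_(m in [set: int]) u m)%E.
Proof.
apply/esym/reindex_esum; split => // [x y _ _ /addIr//|x _].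
by exists (x - 1) => //; rewrite subrK.
Qed.

(** Since [b <= 2 * a], the tile of length [b] with index [m] is covered by the tiles of length [a]
    with indices [m] and [m + 1], so every point is counted at most twice. *)
Lemma esum_tile_le (b : R) (f : T -> \bar R) : b <= 2 * a -> measurable_fun [set: T] f ->
  (forall x, (0 <= f x)%E) ->
  (\esum_(m in [set: int]) \int[mu]_(x in tile b m) f x <= 2%:E * \int[mu]_x f x)%E.
Proof.
move=> ba mf f0; have -> : 2%:E = (1%:E + 1%:E)%E :> \bar R by [].
rewrite ge0_muleDl ?lee_fin// !mul1e.
rewrite integral_tile//.
rewrite -[X in (_ <= _ + X)%E](esum_shift_int (fun m => \int[mu]_(x in tile a m) f x)%E).
rewrite -esumD; [|by move=> m _; exact: integral_ge0..].
apply: le_esum => m _; rewrite -ge0_integral_setU//=.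
- apply: ge0_subset_integral => //; [exact: measurable_itv|apply: measurableU; exact: measurable_itv| |].
    exact: measurable_funTS.
  move=> x; rewrite /tile/= !in_itv/= rmorphD/= mulrDl mul1r => /andP[mx xb].
  case: (ltP x (m%:~R * a + a)) => H; [left|right]; rewrite ?mx//=; lra.
- exact: measurable_itv.
- exact: measurable_itv.
- by apply: measurable_funTS.
- apply/disj_setPS => x [/tile_floor <- /tile_floor].
  by move=> /eqP; rewrite eq_sym -subr_eq0 addrC addKr.
Qed.

End real_tiling.

(** * Reduction of the frame sum to window sums *)

Section energy.
Context {R : realType}.
Local Notation mu := (@lebesgue_measure R).
Local Notation T := (measurableTypeR R).
Variables (a b c : R) (k : nat).

(** For [x] in the period starting at [m a] and [c <= (k + 1) b], these [k.+1] terms are all the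
    points of [x + b Z] that can lie in the window; negative [i] fall before it and [i > k] after
    it. *)
Definition window (m : int) (f : R -> R) (x : R) : R :=
  \sum_(i < k.+1) f (x + i%:R * b) * chi0 c (x + i%:R * b - m%:~R * a).

Definition energy (f : R -> R) : \bar R :=
  (\esum_(m in [set: int]) \int[mu]_(x in tile a b m) (b * window m f x ^+ 2)%:E)%E.

Lemma chi0E : chi0 c = \1_(`[0, c[%classic : set R) :> (R -> R).
Proof.
apply/funext => t; rewrite indicE mem_setE in_itv/= /chi0.
by case: ifP.
Qed.

Lemma chi0_neq0 t : chi0 c t != 0 -> 0 <= t < c.
Proof. by rewrite /chi0; case: ifP => //; rewrite eqxx. Qed.

Lemma chi0_le1 t : `|chi0 c t| <= 1.
Proof. by rewrite /chi0; case: ifP => _; rewrite ?normr1 ?normr0. Qed.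

Lemma measurable_chi0 (h : R) : measurable_fun [set: T] (fun x : T => chi0 c (x + h)).
Proof.
apply: (@measurable_comp_shift _ h (chi0 c)); rewrite chi0E.
by apply: measurable_indic; exact: measurable_itv.
Qed.

Lemma L2r_L2on (f : R -> R) : L2r f -> L2on mu [set: T] f.
Proof.
move=> [mf f2]; split; first exact: mf.
apply/integrableP; split; first by apply/measurable_EFinP/measurable_funX; exact: mf.
by under eq_integral do rewrite gee0_abs ?lee_fin ?sqr_ge0//.
Qed.

Lemma L2on_subset (D : set T) (f : R -> R) : measurable D -> L2on mu [set: T] f ->
  L2on mu D f.
Proof.
move=> mD [mf f2]; split; first exact: measurable_funTS.
exact: integrableS f2.
Qed.

Lemma L2on_shift (h : R) (f : R -> R) : L2on mu [set: T] f ->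
  L2on mu [set: T] (fun x => f (x + h)).
Proof.
move=> [mf f2]; split; first exact: measurable_comp_shift.
exact: (@integrable_shiftT _ h (fun x => f x ^+ 2)).
Qed.

Lemma L2on_mul_bounded (D : set T) (f u : R -> R) : measurable D -> L2on mu D f ->
  measurable_fun D (u : T -> R) -> (forall x, `|u x| <= 1) ->
  L2on mu D (fun x => f x * u x).
Proof.
move=> mD [mf f2] mu_ u1; split; first exact: measurable_funM.
apply: (le_integrable mD _ _ f2).
  by apply/measurable_EFinP/measurable_funX; exact: measurable_funM.
move=> x _; rewrite lee_fin !normrX normrM lerXn2r ?nnegrE ?mulr_ge0//.
by rewrite ler_piMr.
Qed.

Lemma L2on_window m f (D : set T) : measurable D -> L2r f -> L2on mu D (window m f).
Proof.
move=> mD /L2r_L2on Lf; apply: L2on_subset => //; rewrite /window.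
apply: (@L2on_sum _ _ _ mu setT measurableT) => i; apply: L2on_mul_bounded => //.
- exact: L2on_shift.
- by under eq_fun do rewrite -addrA; exact: measurable_chi0.
- by move=> x; exact: chi0_le1.
Qed.

Hypotheses (b_gt0 : 0 < b) (cb : c <= k.+1%:R * b).

Section coefficient.
Variables (m n : int) (fr fi : R -> R).
Hypotheses (Lr : L2r fr) (Li : L2r fi).
Local Notation I := (tile a b m).
Local Notation cs := (fun t => cos (gabor_angle b n t)).
Local Notation sn := (fun t => sin (gabor_angle b n t)).
Let al := m%:~R * a.

Let mI : measurable (I : set T). Proof. exact: measurable_itv. Qed.

Let L2on_chi : L2on mu [set: T] (fun x => chi0 c (x - al)).
Proof.
split; first exact: measurable_chi0.
have -> : (fun x : T => (chi0 c (x - al) ^+ 2)%:E) =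
    EFin \o (\1_(`[al, al + c[%classic : set T) : T -> R).
  apply/funext => x /=; rewrite indicE mem_setE in_itv/= /chi0 subr_ge0 ltrBlDl.
  by case: ifP; rewrite ?expr1n ?expr0n.
have mJ : measurable (`[al, al + c[%classic : set T) by exact: measurable_itv.
apply/integrableP; split; first by apply/measurable_EFinP; exact: (measurable_indic mJ).
under eq_integral do rewrite gee0_abs ?lee_fin//.
rewrite integral_indic//.
rewrite setIT; have := @lebesgue_measure_itv R `[al, al + c[ => /= ->.
by case: ifP => // _; rewrite -EFinB ltry.
Qed.

Let Lcs : L2on mu [set: T] (fun x => chi0 c (x - al) * cs x).
Proof.
by apply: L2on_mul_bounded => //; [exact: measurable_cos_gabor_angle|
  move=> x; exact: cos_max].
Qed.

Let Lsn : L2on mu [set: T] (fun x => chi0 c (x - al) * sn x).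
Proof.
by apply: L2on_mul_bounded => //; [exact: measurable_sin_gabor_angle|
  move=> x; exact: sin_max].
Qed.

Lemma int_window (f : R -> R) (u : R -> R) : L2r f -> L2on mu [set: T] (fun x => chi0 c (x - al) * u x) ->
  (forall x i, u (x + i%:R * b) = u x) ->
  Rintegral mu [set: T] (fun x => f x * (chi0 c (x - al) * u x)) =
  dotp mu I (window m f) u.
Proof.
move=> Lf Lu pu.
rewrite (@Rintegral_periodize _ al b k.+1)//.
- rewrite /dotp; apply: eq_Rintegral => x _; rewrite /window mulr_suml.
  by apply: eq_bigr => i _; rewrite pu mulrA.
- by apply: L2onM => //; exact: L2r_L2on.
- move=> x; rewrite !mulf_eq0 !negb_or => /and3P[_ /chi0_neq0 /andP[x0 xc] _].
  by rewrite -subr_ge0 x0/= -ltrBlDl (lt_le_trans xc).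
Qed.

Lemma cinner_window :
  cinner fr fi (gabor_atom_re (chi0 c) (@zero_fun R) a b m n)
               (gabor_atom_im (chi0 c) (@zero_fun R) a b m n) =
  (dotp mu I (window m fr) cs - dotp mu I (window m fi) sn,
   dotp mu I (window m fi) cs + dotp mu I (window m fr) sn).
Proof.
have pc x i : cs (x + i%:R * b) = cs x by exact: cos_gabor_angle_addbn.
have ps x i : sn (x + i%:R * b) = sn x by exact: sin_gabor_angle_addbn.
rewrite -!int_window//; rewrite -RintegralB// -?RintegralD//;
  try by apply: L2onM => //; exact: L2r_L2on.
by congr pair; apply: eq_Rintegral => x _;
  rewrite /gabor_atom_re /gabor_atom_im /zero_fun /al; ring.
Qed.

End coefficient.

Lemma esum_oppz (u : int -> \bar R) :
  (\esum_(n in [set: int]) u (- n)%R = \esum_(n in [set: int]) u n)%E.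
Proof.
by apply/esym/reindex_esum.
Qed.

(** Meant for the squared moduli of the complex coefficients against the squares of the Hartley
    coefficients. For a given [n] they differ by products of one cosine and one sine integral, which
    are odd in [n], so they agree only after pairing [n] with [- n]. *)
Lemma esum_symmetrize (u v : int -> \bar R) : (forall n, (0 <= u n)%E) ->
  (forall n, (0 <= v n)%E) -> (forall n, (u n + u (- n)%R = v n + v (- n)%R)%E) ->
  (\esum_(n in [set: int]) u n = \esum_(n in [set: int]) v n)%E.
Proof.
move=> u0 v0 uv.
have D (w : int -> \bar R) : (forall n, (0 <= w n)%E) ->
    ((\esum_(n in [set: int]) w n) *+ 2 = \esum_(n in [set: int]) (w n + w (- n)%R))%E.
  by move=> w0; rewrite esumD// esum_oppz mule2n.
have : ((\esum_(n in [set: int]) u n) *+ 2 = (\esum_(n in [set: int]) v n) *+ 2)%E.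
  by rewrite !D//; apply: eq_esum.
rewrite !mule2n.
have : (0 <= \esum_(n in [set: int]) u n)%E by exact: esum_ge0.
have : (0 <= \esum_(n in [set: int]) v n)%E by exact: esum_ge0.
case: (\esum_(n in _) u n)%E => [x||]; case: (\esum_(n in _) v n)%E => [y||] //=.
by move=> _ _ [] H; congr EFin; lra.
Qed.

Lemma esum_coef_window m fr fi : L2r fr -> L2r fi ->
  (\esum_(n in [set: int]) gabor_coef2 (chi0 c) (@zero_fun R) a b fr fi (m, n) =
   \int[mu]_(x in tile a b m) (b * window m fr x ^+ 2)%:E +
   \int[mu]_(x in tile a b m) (b * window m fi x ^+ 2)%:E)%E.
Proof.
move=> Lr Li; have mI : measurable (tile a b m : set T) by exact: measurable_itv.
have Lwr := L2on_window m mI Lr; have Lwi := L2on_window m mI Li.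
have bI f : L2on mu (tile a b m) (window m f) ->
    (\int[mu]_(x in tile a b m) (b * window m f x ^+ 2)%:E =
     (b * dotp mu (tile a b m) (window m f) (window m f))%:E)%E.
  move=> Lf; rewrite EFinM dotpE//.
  have mw : measurable_fun (tile a b m : set T) (fun x => (window m f x ^+ 2)%:E).
    by apply/measurable_EFinP/measurable_funX; exact: Lf.1.
  by rewrite -ge0_integralZl// ?lee_fin ?ltW// => x _; rewrite lee_fin sqr_ge0.
rewrite !bI//.
have := parseval_cas b_gt0 Lwr; have := parseval_cas b_gt0 Lwi.
rewrite -/(tile a b m) => <- <-.
rewrite -esumD; [|by move=> n _; rewrite lee_fin sqr_ge0..].
apply: esum_symmetrize.
- by move=> n; rewrite lee_fin addr_ge0 ?sqr_ge0.
- by move=> n; rewrite adde_ge0// lee_fin sqr_ge0.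
move=> n; rewrite /gabor_coef2 !cinner_window//= -!EFinD; congr EFin.
have Lc (q : int) : L2on mu (tile a b m) (fun t => cos (gabor_angle b q t)).
  apply: (@L2on_bounded _ _ _ _ _ _ _ 1) => //; first exact: period_lty.
    by apply: measurable_funTS; exact: measurable_cos_gabor_angle.
  by move=> x _; exact: cos_max.
have Ls (q : int) : L2on mu (tile a b m) (fun t => sin (gabor_angle b q t)).
  apply: (@L2on_bounded _ _ _ _ _ _ _ 1) => //; first exact: period_lty.
    by apply: measurable_funTS; exact: measurable_sin_gabor_angle.
  by move=> x _; exact: sin_max.
have Ec f (q : int) : L2on mu (tile a b m) f -> dotp mu (tile a b m) f (cas b q) =
    dotp mu (tile a b m) f (fun t => cos (gabor_angle b q t)) +
    dotp mu (tile a b m) f (fun t => sin (gabor_angle b q t)).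
  by move=> Lf; rewrite -dotpDr.
have Nc : (fun t => cos (gabor_angle b (- n) t)) = (fun t => cos (gabor_angle b n t)).
  by apply/funext => t; rewrite gabor_angleN cosN.
have Ns f : L2on mu (tile a b m) f ->
    dotp mu (tile a b m) f (fun t => sin (gabor_angle b (- n) t)) =
    - dotp mu (tile a b m) f (fun t => sin (gabor_angle b n t)).
  move=> Lf; rewrite -[RHS]mulN1r -dotpZr//; congr dotp.
  by apply/funext => t; rewrite gabor_angleN sinN mulN1r.
rewrite !Ec// Nc !Ns//; ring.
Qed.

Lemma window_ge0 m f x : (0 <= (b * window m f x ^+ 2)%:E)%E.
Proof. by rewrite lee_fin mulr_ge0 ?sqr_ge0// ltW. Qed.

(** Because the window function is real, the real and imaginary parts decouple, and both frame
    bounds reduce to estimates for real functions. *)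
Theorem gabor_sum_energy fr fi : L2c fr fi ->
  (\esum_(mn in [set: int * int]) gabor_coef2 (chi0 c) (@zero_fun R) a b fr fi mn =
   energy fr + energy fi)%E.
Proof.
move=> [Lr Li].
transitivity (\esum_(m in [set: int]) \esum_(n in [set: int])
   gabor_coef2 (chi0 c) (@zero_fun R) a b fr fi (m, n))%E.
  rewrite (@esum_esum _ _ _ setT (fun=> setT)
    (fun m n => gabor_coef2 (chi0 c) (@zero_fun R) a b fr fi (m, n))); last first.
    by move=> m n _ _; rewrite lee_fin addr_ge0 ?sqr_ge0.
  rewrite (_ : _ `*`` _ = setT); last by apply/seteqP; split.
  by apply: eq_esum => -[].
rewrite /energy -esumD; last 2 first.
- by move=> m _; apply: integral_ge0 => x _; exact: window_ge0.
- by move=> m _; apply: integral_ge0 => x _; exact: window_ge0.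
by apply: eq_esum => m _; exact: esum_coef_window.
Qed.

End energy.

(** * From pointwise estimates to frame bounds *)

Section frame_criterion.
Context {R : realType}.
Local Notation mu := (@lebesgue_measure R).
Local Notation T := (measurableTypeR R).
Variables (a b c0 : R) (k : nat).
Let c := k%:R * b + c0.
Hypotheses (a_gt0 : 0 < a) (ab : a < b) (c0_gt : b - a < c0) (c0_lt : c0 < a).
Local Ltac slra := move: (a_gt0) (ab) (c0_gt) (c0_lt); lra.

Let b_gt0 : 0 < b. Proof. exact: lt_trans ab. Qed.
Let cb : c <= k.+1%:R * b. Proof. by rewrite /c -natr1 mulrDl mul1r lerD2l ltW// (lt_trans c0_lt). Qed.

Definition wrap (x : R) : R := x - (Num.floor (x / a))%:~R * a.

Lemma wrap_itv x : 0 <= wrap x < a.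
Proof.
have := floor_tile a_gt0 x; rewrite /tile/= in_itv/= /wrap => /andP[? ?].
by apply/andP; split; lra.
Qed.

Lemma wrapE x m : tile a a m x -> wrap x = x - m%:~R * a.
Proof. by move=> /(tile_floor a_gt0); rewrite /wrap => ->. Qed.

Lemma wrap_shift x (y de : R) (z : int) : y = z%:~R * a + de ->
  0 <= wrap x + de < a -> wrap (x + y) = wrap x + de.
Proof.
move=> yE H; rewrite (@wrapE _ (Num.floor (x / a) + z)).
  by rewrite /wrap yE rmorphD/=; ring.
move: H; rewrite /tile/= in_itv/= /wrap yE rmorphD/= mulrDl => /andP[? ?].
by apply/andP; split; lra.
Qed.

Lemma wrap_diff x (y : R) : exists z : int, wrap (x + y) - wrap x = y - z%:~R * a.
Proof.
exists (Num.floor ((x + y) / a) - Num.floor (x / a)).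
by rewrite /wrap rmorphB/=; ring.
Qed.

Lemma measurable_wrap : measurable_fun [set: T] (wrap : T -> T).
Proof.
apply: measurable_funB => //; apply: measurable_funM => //.
apply: nondecreasing_measurable => // x y xy.
by rewrite ler_int; apply: le_floor; rewrite ler_pM2r// invr_gt0.
Qed.

(** A window sum with [u] standing for the distance from the start of the window to [x]. When
    [0 <= u < b] the first [k] points always lie in the window, and the last one does exactly when
    [u < c0]. *)
Definition run (f : R -> R) (u x : R) : R :=
  \sum_(i < k) f (x + i%:R * b) + f (x + k%:R * b) * chi0 c0 u.

(* For x in [m a, m a + a) the two runs are the window sum of index m at x and that of index m + 1
   at x + b. *)
Definition defect (f : R -> R) (x : R) : R :=
  run f (wrap x) x ^+ 2 + run f (wrap x + (b - a)) (x + b) ^+ 2.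

Lemma defect_ge0 f x : 0 <= defect f x.
Proof. by rewrite addr_ge0 ?sqr_ge0. Qed.

Lemma window_run m f x : tile a b m x -> window a b c k m f x = run f (x - m%:~R * a) x.
Proof.
rewrite /tile/= in_itv/= => /andP[mx xm]; rewrite /window big_ord_recr/=; congr (_ + _).
  apply: eq_bigr => i _; rewrite /chi0.
  have i0 : 0 <= i%:R * b by rewrite mulr_ge0// ltW.
  have ik : i%:R * b + b <= k%:R * b.
    rewrite -[X in _ + X]mul1r -mulrDl ler_pM2r// natr1 ler_nat; exact: ltn_ord.
  have -> : (0 <= x + i%:R * b - m%:~R * a) = true by apply/idP; slra.
  have -> : (x + i%:R * b - m%:~R * a < c) = true by apply/idP; rewrite /c; slra.
  by rewrite mulr1.
have k0 : 0 <= k%:R * b by rewrite mulr_ge0// ltW.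
congr (_ * _); rewrite /chi0 /c.
have -> : (0 <= x + k%:R * b - m%:~R * a) = true by apply/idP; slra.
have -> : (0 <= x - m%:~R * a) = true by apply/idP; slra.
by rewrite (_ : (x + _ - _ < _) = (x - m%:~R * a < c0))//; apply/idP/idP; slra.
Qed.

Lemma measurable_run (f u : R -> R) (h : R) : measurable_fun [set: T] (f : T -> R) ->
  measurable_fun [set: T] (u : T -> T) ->
  measurable_fun [set: T] (fun x : T => run f (u x) (x + h)).
Proof.
move=> mf mu_; apply: measurable_funD.
  apply: measurable_sum => i; under eq_fun do rewrite -addrA.
  exact: measurable_comp_shift.
apply: measurable_funM.
  by under eq_fun do rewrite -addrA; exact: measurable_comp_shift.
apply: measurableT_comp => //.
have := @measurable_chi0 R c0 0.
by under eq_fun do rewrite addr0.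
Qed.

Lemma measurable_run_wrap (f : R -> R) : measurable_fun [set: T] (f : T -> R) ->
  measurable_fun [set: T] (fun x : T => run f (wrap x) x).
Proof.
move=> mf; have := @measurable_run f wrap 0 mf measurable_wrap.
by under eq_fun do rewrite addr0.
Qed.

Lemma measurable_run_wrapb (f : R -> R) : measurable_fun [set: T] (f : T -> R) ->
  measurable_fun [set: T] (fun x : T => run f (wrap x + (b - a)) (x + b)).
Proof.
move=> mf; apply: (@measurable_run f (fun x => wrap x + (b - a))) => //.
by apply: measurable_funD => //; exact: measurable_wrap.
Qed.

Lemma measurable_defect (f : R -> R) : measurable_fun [set: T] (f : T -> R) ->
  measurable_fun [set: T] (defect f : T -> R).
Proof.
move=> mf; apply: measurable_funD; apply: measurable_funX.
  exact: measurable_run_wrap.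
exact: measurable_run_wrapb.
Qed.

Lemma measurable_window m (f : R -> R) : measurable_fun [set: T] (f : T -> R) ->
  measurable_fun [set: T] (fun x : T => (b * window a b c k m f x ^+ 2)%:E).
Proof.
move=> mf; apply/measurable_EFinP; apply: measurable_funM => //; apply: measurable_funX.
apply: measurable_sum => i; apply: measurable_funM; first exact: measurable_comp_shift.
by under eq_fun do rewrite -addrA; exact: measurable_chi0.
Qed.

(** If [x] lies in [m a, m a + a), then [x] lies in the period starting at [m a] and [x + b] in the
    one starting at [(m + 1) a]. So each of the two squares integrates to at most the energy, whence
    the factor 2. *)
Lemma defect_le_energy (f : R -> R) : measurable_fun [set: T] (f : T -> R) ->
  (\int[mu]_x (b * defect f x)%:E <= 2%:E * energy a b c k f)%E.
Proof.
move=> mf.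
have m1 : measurable_fun [set: T] (fun x : T => (b * run f (wrap x) x ^+ 2)%:E).
  apply/measurable_EFinP; apply: measurable_funM => //; apply: measurable_funX.
  exact: measurable_run_wrap.
have m2 : measurable_fun [set: T] (fun x : T => (b * run f (wrap x + (b - a)) (x + b) ^+ 2)%:E).
  apply/measurable_EFinP; apply: measurable_funM => //; apply: measurable_funX.
  exact: measurable_run_wrapb.
have p x : (0 <= (b * x ^+ 2)%:E)%E by rewrite lee_fin mulr_ge0 ?sqr_ge0// ltW.
under eq_integral do rewrite /defect mulrDr EFinD.
rewrite ge0_integralD//.
have -> : (2%:E * energy a b c k f = energy a b c k f + energy a b c k f)%E.
  by rewrite -mule2n mule_natl.
rewrite (integral_tile a_gt0 m1)// (integral_tile a_gt0 m2)//.
have sub : a <= b by exact: ltW.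
apply: leeD.
  apply: le_esum => m _.
  rewrite (eq_integral (fun x : T => (b * window a b c k m f x ^+ 2)%:E)); last first.
    move=> x; rewrite inE => xm; rewrite (wrapE xm) window_run//.
    by move: xm; rewrite /tile/= !in_itv/= => /andP[-> H] /=; apply: lt_le_trans H _; rewrite lerD2l.
  apply: ge0_subset_integral => //; try exact: measurable_itv.
    by apply: measurable_funTS; exact: measurable_window.
  by move=> x; rewrite /tile/= !in_itv/= => /andP[-> H] /=; apply: lt_le_trans H _; rewrite lerD2l.
rewrite [leRHS]/energy -[leRHS]esum_shift_int; apply: le_esum => m _.
rewrite (eq_integral (fun x : T => (b * window a b c k (m + 1) f (x + b) ^+ 2)%:E)); last first.
  move=> x; rewrite inE => xm; rewrite (wrapE xm) window_run.
    suff -> : x + b - (m + 1)%:~R * a = x - m%:~R * a + (b - a) by [].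
    by rewrite rmorphD/= mulrDl mul1r; ring.
  move: xm; rewrite /tile/= !in_itv/= rmorphD/= mulrDl mul1r => /andP[? ?].
  by apply/andP; split; slra.
rewrite -(@ge0_integral_shift_itv _ b _ _ (fun x : T => (b * window a b c k (m + 1) f x ^+ 2)%:E))//;
  last exact: measurable_window.
apply: ge0_subset_integral => //; try exact: measurable_itv.
  by apply: measurable_funTS; exact: measurable_window.
move=> x; rewrite /tile/= !in_itv/= rmorphD/= mulrDl mul1r => /andP[? ?].
by apply/andP; split; slra.
Qed.

Lemma sqr_sum_le (n : nat) (u : 'I_n -> R) :
  (\sum_i u i) ^+ 2 <= n%:R * \sum_i u i ^+ 2.
Proof.
elim: n u => [|n ih] u; first by rewrite !big_ord0 expr0n mul0r.
rewrite !big_ord_recr/=; set v := u ord_max.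
have := ih (fun i => u (widen_ord (leqnSn n) i)).
set s := \sum_(i < n) _; set t := \sum_(i < n) _ => H.
have [n0|n0] := posnP n.
  have -> : s = 0 by rewrite /s; move: (n0) => e; apply: big1 => -[i Hi]; exfalso; move: Hi; rewrite e.
  have t0 : 0 <= t by apply: sumr_ge0 => i _; exact: sqr_ge0.
  by rewrite n0 add0r mul1r lerDr.
have n0R : 0 < n%:R :> R by rewrite ltr0n.
have : 0 <= n%:R^-1 * (s - n%:R * v) ^+ 2 by rewrite mulr_ge0 ?sqr_ge0// invr_ge0 ltW.
have -> : n%:R^-1 * (s - n%:R * v) ^+ 2 = n%:R^-1 * s ^+ 2 - 2 * s * v + n%:R * v ^+ 2.
  by field; rewrite gt_eqF.
have : n%:R^-1 * s ^+ 2 <= t by rewrite mulrC ler_pdivrMr// mulrC.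
rewrite -natr1; nra.
Qed.

Lemma sume_const_ord (n : nat) (x : \bar R) : (0 <= x)%E ->
  (\sum_(i < n) x = n%:R%:E * x)%E.
Proof.
move=> x0; elim: n => [|n ih]; first by rewrite big_ord0 mul0e.
by rewrite big_ord_recr/= ih -natr1 EFinD ge0_muleDl ?lee_fin// mul1e.
Qed.

(** In the constant, [b] comes from Parseval, one factor [k.+1] from Cauchy-Schwarz, the other from
    the number of translates, and 2 from the overlap of the periods. *)
Lemma energy_le (f : R -> R) : measurable_fun [set: T] (f : T -> R) ->
  (energy a b c k f <= (2 * b * k.+1%:R ^+ 2)%:E * \int[mu]_x (f x ^+ 2)%:E)%E.
Proof.
move=> mf.
pose g (x : T) : \bar R := (\sum_(i < k.+1) (b * k.+1%:R * f (x + i%:R * b) ^+ 2)%:E)%E.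
have mt (i : 'I_k.+1) : measurable_fun [set: T] (fun x : T => (b * k.+1%:R * f (x + i%:R * b) ^+ 2)%:E).
  apply/measurable_EFinP; apply: measurable_funM => //; apply: measurable_funX.
  exact: measurable_comp_shift.
have pt (i : 'I_k.+1) (x : T) : (0 <= (b * k.+1%:R * f (x + i%:R * b) ^+ 2)%:E)%E.
  by rewrite lee_fin; apply: mulr_ge0; [apply: mulr_ge0 => //; exact: ltW|exact: sqr_ge0].
have mg : measurable_fun [set: T] g by apply: emeasurable_sum.
have g0 x : (0 <= g x)%E by apply: sume_ge0.
apply: (@le_trans _ _ (\esum_(m in [set: int]) \int[mu]_(x in tile a b m) g x)%E).
  apply: le_esum => m _; apply: ge0_le_integral => //.
  - exact: measurable_itv.
  - by move=> x _; rewrite lee_fin mulr_ge0 ?sqr_ge0// ltW.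
  - by apply: measurable_funTS; exact: measurable_window.
  - exact: measurable_funTS.
  move=> x _; rewrite /g sumEFin lee_fin.
  rewrite -mulr_sumr -mulrA ler_pM2l//.
  apply: le_trans (sqr_sum_le _) _; rewrite ler_wpM2l//.
  apply: ler_sum => i _; rewrite exprMn ler_piMr ?sqr_ge0// -real_normK ?num_real//.
  by rewrite exprn_ile1// chi0_le1.
apply: le_trans (esum_tile_le a_gt0 _ mg g0) _; first slra.
rewrite /g ge0_integral_sum//.
have -> : (\sum_(i < k.+1) \int[mu]_x (b * k.+1%:R * f (x + i%:R * b) ^+ 2)%:E =
    \sum_(i < k.+1) (b * k.+1%:R)%:E * \int[mu]_x (f x ^+ 2)%:E)%E.
  apply: eq_bigr => i _.
  rewrite (@ge0_integral_shiftT _ (i%:R * b) (fun x : T => (b * k.+1%:R * f x ^+ 2)%:E)).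
  - rewrite -ge0_integralZl//.
    + by apply/measurable_EFinP; apply: measurable_funX.
    + by move=> x _; rewrite lee_fin sqr_ge0.
    + by rewrite lee_fin mulr_ge0// ltW.
  - by apply/measurable_EFinP; apply: measurable_funM => //; apply: measurable_funX.
  - by move=> x; rewrite lee_fin; apply: mulr_ge0; [apply: mulr_ge0 => //; exact: ltW|exact: sqr_ge0].
have N0 : (0 <= \int[mu]_x (f x ^+ 2)%:E)%E.
  by apply: integral_ge0 => x _; rewrite lee_fin sqr_ge0.
rewrite sume_const_ord; last by rewrite mule_ge0// lee_fin mulr_ge0// ltW.
by rewrite !muleA -!EFinM le_eqVlt; apply/orP; left; apply/eqP; congr (_%:E * _)%E; ring.
Qed.

(** Integration turns the [M] translates into [M] equal integrals, and comparing defect with energy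
    costs 2 / b; this gives [A]. The upper bound is [energy_le], enlarged to [Num.max A B] so that
    it dominates [A] at once. *)
Theorem frame_of_defect (K : R) (M : nat) : 0 < K -> (0 < M)%N ->
  (forall f x, f x ^+ 2 <= K * \sum_(r < M) defect f (x + r%:R * b)) ->
  gabor_frame (chi0 c) (@zero_fun R) a b.
Proof.
move=> K0 M0 H.
have M0R : 0 < M%:R :> R by rewrite ltr0n.
pose A := b / (2 * M%:R * K); pose B := 2 * b * k.+1%:R ^+ 2.
have A0 : 0 < A by rewrite divr_gt0// !mulr_gt0.
have lower (f : R -> R) : L2r f -> (A%:E * \int[mu]_x (f x ^+ 2)%:E <= energy a b c k f)%E.
  move=> [mf _].
  have md i : measurable_fun [set: T] (fun x : T => (K / b * (b * defect f (x + i * b)))%:E).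
    apply/measurable_EFinP; apply: measurable_funM => //; apply: measurable_funM => //.
    by apply: measurable_comp_shift; exact: measurable_defect.
  have pd i (x : T) : (0 <= (K / b * (b * defect f (x + i * b)))%:E)%E.
    by rewrite lee_fin mulrA divfK ?gt_eqF// mulr_ge0 ?defect_ge0// ltW.
  have : (\int[mu]_x (f x ^+ 2)%:E <=
      \int[mu]_x \sum_(r < M) (K / b * (b * defect f (x + r%:R * b)))%:E)%E.
    apply: ge0_le_integral => //.
    - by move=> x _; rewrite lee_fin sqr_ge0.
    - by apply/measurable_EFinP; apply: measurable_funX.
    - by apply: emeasurable_sum => i; exact: md.
    - move=> x _; rewrite sumEFin lee_fin; apply: le_trans (H f x) _.
      rewrite mulr_sumr ler_sum// => r _; rewrite mulrA divfK// gt_eqF//.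
  rewrite ge0_integral_sum//.
  have -> : (\sum_(r < M) \int[mu]_x (K / b * (b * defect f (x + r%:R * b)))%:E =
      \sum_(r < M) (K / b)%:E * \int[mu]_x (b * defect f x)%:E)%E.
    apply: eq_bigr => r _.
    rewrite (@ge0_integral_shiftT _ (r%:R * b) (fun x : T => (K / b * (b * defect f x))%:E)).
    - rewrite -ge0_integralZl//.
      + apply/measurable_EFinP; apply: measurable_funM => //; exact: measurable_defect.
      + by move=> x _; rewrite lee_fin mulr_ge0 ?defect_ge0// ltW.
      + by rewrite lee_fin divr_ge0// ltW.
    - by have := md 0; under eq_fun do rewrite mul0r addr0.
    - by move=> x; have := pd 0 x; rewrite mul0r addr0.
  have N0 : (0 <= \int[mu]_x (b * defect f x)%:E)%E.
    by apply: integral_ge0 => x _; rewrite lee_fin mulr_ge0 ?defect_ge0// ltW.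
  rewrite sume_const_ord; last by rewrite mule_ge0// lee_fin divr_ge0// ltW.
  rewrite muleA => H1.
  apply: (@le_trans _ _ (A%:E * ((M%:R%:E * (K / b)%:E) * (2%:E * energy a b c k f)))%E).
    apply: lee_pmul => //; first by rewrite lee_fin ltW.
      by apply: integral_ge0 => x _; rewrite lee_fin sqr_ge0.
    apply: (le_trans H1); apply: lee_pmul => //.
    - by rewrite -EFinM lee_fin mulr_ge0 ?divr_ge0// ltW.
    - exact: defect_le_energy.
  rewrite !muleA -!EFinM (_ : A * _ * _ * _ = 1) ?mul1e// /A.
  by field; rewrite !gt_eqF.
have upper (f : R -> R) : L2r f -> (energy a b c k f <= (Num.max A B)%:E * \int[mu]_x (f x ^+ 2)%:E)%E.
  move=> [mf _]; apply: le_trans (energy_le mf) _.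
  apply: lee_wpmul2r; first by apply: integral_ge0 => x _; rewrite lee_fin sqr_ge0.
  by rewrite lee_fin le_max lexx orbT.
exists A, (Num.max A B); split => //; split; first by rewrite le_max lexx.
move=> fr fi L; have [Lr Li] := L.
rewrite (gabor_sum_energy a b_gt0 cb L) /sqnorm2.
have -> : (\int[mu]_x (fr x ^+ 2 + fi x ^+ 2)%:E =
    \int[mu]_x (fr x ^+ 2)%:E + \int[mu]_x (fi x ^+ 2)%:E)%E.
  under eq_integral do rewrite EFinD.
  rewrite ge0_integralD//; try by move=> x _; rewrite lee_fin sqr_ge0.
  - by apply/measurable_EFinP; apply: measurable_funX; exact: Lr.1.
  - by apply/measurable_EFinP; apply: measurable_funX; exact: Li.1.
have pos (f : R -> R) : (0 <= \int[mu]_x (f x ^+ 2)%:E)%E.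
  by apply: integral_ge0 => x _; rewrite lee_fin sqr_ge0.
by split; rewrite ge0_muleDr//; apply: leeD; [exact: lower|exact: lower|exact: upper|exact: upper].
Qed.

End frame_criterion.

(** * Frame bounds *)

Section recovery.
Context {R : realType}.
Variables (a b c0 : R) (k : nat).
Hypotheses (a_gt0 : 0 < a) (ab : a < b) (c0_gt : b - a < c0) (c0_lt : c0 < a).
Local Ltac slra := move: (a_gt0) (ab) (c0_gt) (c0_lt); lra.
Hypothesis k_gt0 : (0 < k)%N.
Implicit Types (f : R -> R) (x : R).
Local Notation rn := (run b c0 k).
Local Notation wr := (wrap a).

(** A first-power version of [defect]: along an orbit these errors add up by the triangle
    inequality, and squares return only in [frame_of_gaps]. *)
Definition gap f x : R := `|rn f (wr x) x| + `|rn f (wr x + (b - a)) (x + b)|.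
Definition gaps f (n : nat) x : R := \sum_(r < n) gap f (x + r%:R * b).

Lemma gap_ge0 f x : 0 <= gap f x.
Proof. by rewrite addr_ge0. Qed.

Lemma gaps_ge0 f n x : 0 <= gaps f n x.
Proof. by apply: sumr_ge0 => i _; exact: gap_ge0. Qed.

Lemma gaps_shift f j m x : gaps f (j + m) x = gaps f j x + gaps f m (x + j%:R * b).
Proof.
rewrite /gaps big_split_ord/=; congr (_ + _); apply: eq_bigr => i _.
by congr (gap f _); rewrite natrD; ring.
Qed.

Lemma le_gaps f m n x : (m <= n)%N -> gaps f m x <= gaps f n x.
Proof. by move=> /subnKC <-; rewrite gaps_shift lerDl gaps_ge0. Qed.

Lemma gap_le_gaps f n x : (0 < n)%N -> gap f x <= gaps f n x.
Proof.
move=> n0; apply: le_trans (le_gaps f x n0).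
by rewrite /gaps big_ord1 mul0r addr0.
Qed.

Lemma gap_add_gaps f j m x : (0 < j)%N ->
  gap f x + gaps f m (x + j%:R * b) <= gaps f (j + m) x.
Proof. by move=> j0; rewrite gaps_shift lerD2r gap_le_gaps. Qed.

Lemma gaps_comp_shift f j m n x : (j + m <= n)%N -> gaps f m (x + j%:R * b) <= gaps f n x.
Proof.
move=> jm; apply: le_trans (le_gaps f x jm).
by rewrite gaps_shift lerDr gaps_ge0.
Qed.

(** The sums telescope to their end terms, so the two indicators alone decide what is compared with
    [f x]. In the hole the first run has its last term and the second does not, and everything but
    [- f x] cancels. *)
Lemma run_diff f u v x : rn f v (x + b) - rn f u x =
  f (x + k%:R * b) - f x + f (x + k.+1%:R * b) * chi0 c0 v - f (x + k%:R * b) * chi0 c0 u.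
Proof.
rewrite /run.
have -> : x + b + k%:R * b = x + k.+1%:R * b by rewrite -natr1; ring.
have : \sum_(i < k) f (x + b + i%:R * b) - \sum_(i < k) f (x + i%:R * b)
       = f (x + k%:R * b) - f x.
  rewrite -sumrB; elim: (k) => [|n ih]; first by rewrite big_ord0 mul0r addr0 subrr.
  rewrite big_ord_recr/= ih; have -> : x + b + n%:R * b = x + n.+1%:R * b by rewrite -natr1; ring.
  ring.
slra.
Qed.

Lemma gap_diff f x (y : R) : rn f (wr x + (b - a)) (x + b) - rn f (wr x) x = y - f x ->
  `|f x| <= `|y| + gap f x.
Proof.
move=> H; have -> : f x = y + (rn f (wr x) x - rn f (wr x + (b - a)) (x + b)) by slra.
by apply: le_trans (ler_normD _ _) _; rewrite lerD2l; exact: ler_normB.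
Qed.

Let wrap0 x : 0 <= wr x. Proof. by have /andP[] := wrap_itv a_gt0 x. Qed.
Let wrapa x : wr x < a. Proof. by have /andP[] := wrap_itv a_gt0 x. Qed.

Let chi0_1 u : 0 <= u -> u < c0 -> chi0 c0 u = 1.
Proof. by rewrite /chi0 => -> ->. Qed.

Let chi0_0 u : c0 <= u -> chi0 c0 u = 0.
Proof. by rewrite /chi0 => H; rewrite (ltNge u) H andbF. Qed.

Lemma gap_left f x : wr x < c0 + a - b -> `|f x| <= `|f (x + k.+1%:R * b)| + gap f x.
Proof.
move=> xl; apply: gap_diff; have := wrap0 x => x0.
by rewrite run_diff !chi0_1; slra.
Qed.

Lemma gap_mid f x : c0 + a - b <= wr x < c0 -> `|f x| <= gap f x.
Proof.
move=> /andP[xl xr]; apply: le_trans (@gap_diff f x 0 _) _; last by rewrite normr0 add0r.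
by have := wrap0 x => x0; rewrite run_diff chi0_0 ?chi0_1; slra.
Qed.

Lemma gap_right f x : c0 <= wr x -> `|f x| <= `|f (x + k%:R * b)| + gap f x.
Proof. by move=> xr; apply: gap_diff; rewrite run_diff !chi0_0; slra. Qed.

Let archi (y de : R) : 0 < de -> exists n : nat, y <= n%:R * de.
Proof.
move=> d0; exists (Num.truncn (`|y| / de)).+1.
have := truncnS_gt (`|y| / de); rewrite ltr_pdivrMr// => /ltW; apply: le_trans.
exact: ler_norm.
Qed.

(** A step [de] no longer than the hole cannot jump over it, and a point before the hole stays below
    [c0 < a], so no wrap-around occurs. Each step adds one [gap], and the number of steps is bounded
    by the distance to the hole divided by [de]. *)
Lemma recover_left (z : int) (de : R) : k.+1%:R * b = z%:~R * a + de -> 0 < de <= b - a ->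
  exists M, forall f x, wr x < c0 -> `|f x| <= gaps f M x.
Proof.
move=> zE /andP[d0 db].
(* Here [n] bounds the number of translations by [(k + 1) b] needed to enter the hole. *)
have H n f x : c0 + a - b - n%:R * de <= wr x < c0 -> `|f x| <= gaps f (n * k.+1 + 1) x.
  elim: n f x => [|n ih] f x /andP[xl xr].
    by apply: le_trans (gap_le_gaps f x _) => //; apply: gap_mid; rewrite xr andbT; slra.
  have [xm|xm] := leP (c0 + a - b) (wr x).
    by apply: le_trans (gap_le_gaps f x _); rewrite ?addn1//; apply: gap_mid; rewrite xm.
  apply: le_trans (gap_left f xm) _.
  have wE : wr (x + k.+1%:R * b) = wr x + de.
    by apply: (wrap_shift a_gt0 zE); have := wrap0 x => x0; apply/andP; split; slra.
  have := ih f (x + k.+1%:R * b); rewrite wE => IH.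
  rewrite mulSn -addnA; apply: le_trans (gap_add_gaps f _ x _) => //.
  rewrite addrC lerD2l; apply: IH; move: xl; rewrite -natr1 => xl.
  by apply/andP; split; slra.
have [n nE] := archi (c0 + a - b) d0.
exists (n * k.+1 + 1)%N => f x xc; apply: H; rewrite xc andbT.
by have := wrap0 x; slra.
Qed.

(** Mirror image of [recover_left]: translations by [k b] move the residue down, from the right of
    the hole into it. *)
Lemma recover_right (z : int) (de : R) : k%:R * b = z%:~R * a - de -> 0 < de <= b - a ->
  exists M, forall f x, c0 + a - b <= wr x -> `|f x| <= gaps f M x.
Proof.
move=> zE /andP[d0 db].
have H n f x : c0 + a - b <= wr x < c0 + n%:R * de -> `|f x| <= gaps f (n * k + 1) x.
  elim: n f x => [|n ih] f x /andP[xl xr].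
    by apply: le_trans (gap_le_gaps f x _) => //; apply: gap_mid; rewrite xl; slra.
  have [xm|xm] := ltP (wr x) c0.
    by apply: le_trans (gap_le_gaps f x _); rewrite ?addn1//; apply: gap_mid; rewrite xl.
  apply: le_trans (gap_right f xm) _.
  have wE : wr (x + k%:R * b) = wr x - de.
    by apply: (wrap_shift a_gt0 zE); have := wrapa x => x0; apply/andP; split; slra.
  have := ih f (x + k%:R * b); rewrite wE => IH.
  rewrite mulSn -addnA; apply: le_trans (gap_add_gaps f _ x _) => //.
  rewrite addrC lerD2l; apply: IH; move: xr; rewrite -natr1 => xr.
  by apply/andP; split; slra.
have [n nE] := archi (a - c0) d0.
exists (n * k + 1)%N => f x xc; apply: H; rewrite xc/=.
by have := wrapa x; slra.
Qed.

Lemma frame_of_gaps (C : R) (M : nat) : (forall f x, `|f x| <= C * gaps f M x) ->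
  gabor_frame (chi0 (k%:R * b + c0)) (@zero_fun R) a b.
Proof.
move=> H.
(* The factor 2 compares the square of [gap] with [defect], and [M.+1] is the Cauchy-Schwarz factor.
   [C ^+ 2 + 1] and [M.+1] ensure positivity whatever [C] and [M] are. *)
apply: (@frame_of_defect _ a b c0 k a_gt0 ab c0_gt c0_lt (2 * (C ^+ 2 + 1) * M.+1%:R) M.+1) => //.
  by rewrite !mulr_gt0// ltr_wpDl ?sqr_ge0.
move=> f x; rewrite -real_normK ?num_real//.
have g0 := gaps_ge0 f M x.
apply: (@le_trans _ _ (C ^+ 2 * gaps f M x ^+ 2)).
  by rewrite -exprMn lerXn2r ?nnegrE// (le_trans _ (H f x)).
apply: (@le_trans _ _ ((C ^+ 2 + 1) * gaps f M.+1 x ^+ 2)).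
  have g1 : gaps f M x ^+ 2 <= gaps f M.+1 x ^+ 2.
    by rewrite lerXn2r ?nnegrE ?gaps_ge0// le_gaps.
  have := sqr_ge0 C; have := sqr_ge0 (gaps f M x); nra.
have -> : 2 * (C ^+ 2 + 1) * M.+1%:R * \sum_(r < M.+1) defect a b c0 k f (x + r%:R * b) =
  (C ^+ 2 + 1) * (M.+1%:R * \sum_(r < M.+1) 2 * defect a b c0 k f (x + r%:R * b)).
  by rewrite -mulr_sumr; ring.
rewrite ler_pM2l ?ltr_wpDl ?sqr_ge0//.
apply: le_trans (sqr_sum_le _) _; rewrite ler_wpM2l//; apply: ler_sum => r _.
rewrite /gap /defect; set u := rn _ _ _; set v := rn _ _ _.
rewrite -(real_normK (num_real u)) -(real_normK (num_real v)).
have := sqr_ge0 (`|u| - `|v|); nra.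
Qed.

Lemma frame_generic (z1 z2 : int) (d1 d2 : R) : k.+1%:R * b = z1%:~R * a + d1 ->
  0 < d1 <= b - a -> k%:R * b = z2%:~R * a - d2 -> 0 < d2 <= b - a ->
  gabor_frame (chi0 (k%:R * b + c0)) (@zero_fun R) a b.
Proof.
move=> z1E d1b z2E d2b.
have [M1 H1] := recover_left z1E d1b; have [M2 H2] := recover_right z2E d2b.
apply: (@frame_of_gaps 1 (maxn M1 M2)) => f x; rewrite mul1r.
have [xc|xc] := ltP (wr x) c0.
  by apply: le_trans (H1 f x xc) _; apply: le_gaps; exact: leq_maxl.
apply: le_trans (H2 f x _) _; last by apply: le_gaps; exact: leq_maxr.
slra.
Qed.

(** Here [e] is a single window sum: [f x] is solved from it once the other points of that window
    are controlled. *)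
Let recover_section (n M : nat) f x (e : R) : `|e| <= gap f x ->
  f x = e - \sum_(i < n) f (x + i.+1%:R * b) ->
  (forall i, (i < n)%N -> `|f (x + i.+1%:R * b)| <= gaps f M (x + i.+1%:R * b)) ->
  `|f x| <= (1 + n%:R) * gaps f (n + M).+1 x.
Proof.
move=> eg -> H; apply: le_trans (ler_normB _ _) _; rewrite mulrDl mul1r; apply: lerD.
  by apply: le_trans eg (gap_le_gaps _ _ _).
apply: le_trans (ler_norm_sum _ _ _) _.
apply: (@le_trans _ _ (\sum_(i < n) gaps f (n + M).+1 x)); last by rewrite sumr_const card_ord mulr_natl.
apply: ler_sum => i _; apply: le_trans (H _ (ltn_ord i)) _.
by apply: gaps_comp_shift; rewrite addSn ltnS leq_add2r ltnW.
Qed.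

Let sum_recl n f x : \sum_(i < n.+1) f (x + i%:R * b) =
  f x + \sum_(i < n) f (x + i.+1%:R * b).
Proof. by rewrite big_ord_recl/= mul0r addr0. Qed.

(** Two residues before the hole differ by less than [c0 + a - b]. Hence [sep] forbids a second
    point of the window of [x] from lying before the hole, and all points not before it are
    recovered by the other translation. *)
Lemma frame_left_fixed (z : int) : k.+1%:R * b = z%:~R * a ->
  (forall (i : nat) (y : int), (0 < i < k.+1)%N -> c0 + a - b <= `|i%:R * b - y%:~R * a|) ->
  gabor_frame (chi0 (k%:R * b + c0)) (@zero_fun R) a b.
Proof.
move=> zE sep.
(* k b = z a - b = (z - 1) a - (b - a), so the remaining step is exactly the length of the hole. *)
have [||M H] := @recover_right (z - 1) (b - a).
- by move: zE; rewrite -natr1 rmorphB/=; slra.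
- by apply/andP; split; slra.
apply: (@frame_of_gaps (1 + k%:R) (k + M).+1) => f x.
have [xc|xc] := leP (c0 + a - b) (wr x).
  apply: le_trans (H f x xc) _.
  apply: (@le_trans _ _ (gaps f (k + M).+1 x)).
    by apply: le_gaps; rewrite leqW// leq_addl.
  by rewrite ler_peMl ?gaps_ge0// lerDl.
apply: (@recover_section k M f x (rn f (wr x) x)).
- by rewrite /gap lerDl.
- rewrite /run chi0_1//; last slra.
  rewrite mulr1; have -> : \sum_(i < k) f (x + i%:R * b) + f (x + k%:R * b) =
      \sum_(i < k.+1) f (x + i%:R * b) by rewrite big_ord_recr.
  by rewrite sum_recl addrK.
move=> i ik; apply: H; rewrite leNgt; apply/negP => xi.
have [y yE] := wrap_diff a x (i.+1%:R * b).
have := sep i.+1 y ik; rewrite -yE leNgt => /negP; apply.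
have := wrap0 x; have := wrap0 (x + i.+1%:R * b) => ? ?.
by rewrite ltr_norml; apply/andP; split; slra.
Qed.

(** A window starting at a residue after the hole has only [k] points: the fixed translate [x + k b]
    falls outside it. Residues after the hole differ by less than [a - c0], so [sep] leaves [x] as
    the only uncontrolled point. *)
Lemma frame_right_fixed (z : int) : k%:R * b = z%:~R * a ->
  (forall (i : nat) (y : int), (0 < i < k)%N -> a - c0 <= `|i%:R * b - y%:~R * a|) ->
  gabor_frame (chi0 (k%:R * b + c0)) (@zero_fun R) a b.
Proof.
move=> zE sep.
have [||M H] := @recover_left (z + 1) (b - a).
- by move: zE; rewrite -natr1 rmorphD/=; slra.
- by apply/andP; split; slra.
apply: (@frame_of_gaps (1 + k.-1%:R) (k.-1 + M).+1) => f x.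
have [xc|xc] := ltP (wr x) c0.
  apply: le_trans (H f x xc) _.
  apply: (@le_trans _ _ (gaps f (k.-1 + M).+1 x)).
    by apply: le_gaps; rewrite leqW// leq_addl.
  by rewrite ler_peMl ?gaps_ge0// lerDl.
apply: (@recover_section k.-1 M f x (rn f (wr x) x)).
- by rewrite /gap lerDl.
- rewrite /run chi0_0// mulr0 addr0; have -> : \sum_(i < k) f (x + i%:R * b) =
      \sum_(i < k.-1.+1) f (x + i%:R * b) by rewrite prednK.
  by rewrite sum_recl addrK.
move=> i ik; apply: H; rewrite ltNge; apply/negP => xi.
have [y yE] := wrap_diff a x (i.+1%:R * b).
move: ik; rewrite ltn_predRL => ik; have := sep i.+1 y ik; rewrite -yE leNgt => /negP; apply.
have := wrapa x; have := wrapa (x + i.+1%:R * b) => ? ?.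
by rewrite ltr_norml; apply/andP; split; slra.
Qed.

End recovery.

(** * Failure of the lower frame bound *)

Section periodic_null.
Context {R : realType}.
Local Notation mu := (@lebesgue_measure R).
Local Notation T := (measurableTypeR R).
Variables (a b : R) (P d : nat) (Q z : int) (s0 s1 e eps : R).
Hypotheses (a_gt0 : 0 < a) (b_gt0 : 0 < b) (dP : (0 < d < P)%N).
Hypotheses (PQ : P%:R * b = Q%:~R * a) (dz : d%:R * b = z%:~R * a + e).
Hypotheses (s0_ge0 : 0 <= s0) (e_ge0 : 0 <= e) (eps_gt0 : 0 < eps) (eps_b : eps <= b).
Hypotheses (s01 : s0 + e + eps <= s1) (s1a : s1 <= a).
Local Ltac slra := move: (a_gt0) (b_gt0) (s0_ge0) (e_ge0) (eps_gt0) (eps_b) (s01) (s1a); lra.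

Local Ltac glra := move: (b_gt0) (s0_ge0) (eps_gt0) (eps_b); lra.

Let L := P%:R * b.

Let P_gt0 : (0 < P)%N. Proof. by case/andP: dP => d0; exact: ltn_trans. Qed.
Let L_gt0 : 0 < L. Proof. by rewrite mulr_gt0// ltr0n. Qed.
Let bL : b <= L.
Proof. by rewrite /L -[leLHS]mul1r ler_pM2r// ler1n. Qed.

(** Indicator of teeth of width [eps] starting at the points of [s0 + L Z]. Since [L] is a multiple
    of both [a] and [b], the teeth occupy one fixed interval modulo [a]. *)
Definition comb_ind (x : R) : R := chi0 eps (wrap L (x - s0)).
Local Notation chi := comb_ind.

(** The difference of two fixed classes: modulo [a] the combs occupy intervals starting at [s0] and
    [s0 + e], both inside the side [s0, s1) of the hole. *)
Definition null_fun (x : R) : R := chi x - chi (x - d%:R * b).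

Let wrapL x : wrap L (x + L) = wrap L x.
Proof.
rewrite (@wrap_shift _ L L_gt0 x L 0 1) ?addr0 ?wrap_itv//.
by rewrite mul1r.
Qed.

Lemma comb_ind_periodic x : chi (x + L) = chi x.
Proof. by rewrite /comb_ind (_ : x + L - s0 = x - s0 + L) ?wrapL//; ring. Qed.

Lemma comb_ind_itv x : chi x = 0 \/ chi x = 1.
Proof. by rewrite /comb_ind /chi0; case: ifP => _; [right|left]. Qed.

Lemma measurable_null_fun : measurable_fun [set: T] (null_fun : T -> R).
Proof.
have mchi : measurable_fun [set: T] (chi : T -> R).
  apply: (@measurableT_comp _ _ _ _ _ _ (chi0 eps)).
    by have := @measurable_chi0 R eps 0; under eq_fun do rewrite addr0.
  apply: (@measurable_comp_shift R (- s0) (wrap L : T -> R)).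
  exact: measurable_wrap.
by apply: measurable_funB => //; exact: measurable_comp_shift.
Qed.

Lemma null_fun_le1 x : `|null_fun x| <= 1.
Proof.
rewrite /null_fun; case: (comb_ind_itv x) => ->; case: (comb_ind_itv (x - d%:R * b)) => ->;
  by rewrite ler_norml; lra.
Qed.

Lemma null_fun_periodic x : null_fun (x + L) = null_fun x.
Proof.
rewrite /null_fun comb_ind_periodic (_ : x + L - d%:R * b = x - d%:R * b + L) ?comb_ind_periodic//.
ring.
Qed.

(** The sum of an [L]-periodic function over [P] consecutive translates by [b] is [b]-periodic,
    because L = P b; so both combs have the same sum. *)
Lemma sum_null_fun x : \sum_(i < P) null_fun (x + i%:R * b) = 0.
Proof.
pose g x := \sum_(i < P) chi (x + i%:R * b).
have gb y : g (y + b) = g y.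
  rewrite /g; have := prednK P_gt0 => PE.
  have -> : \sum_(i < P) chi (y + b + i%:R * b) = \sum_(i < P.-1.+1) chi (y + b + i%:R * b) by rewrite PE.
  have -> : \sum_(i < P) chi (y + i%:R * b) = \sum_(i < P.-1.+1) chi (y + i%:R * b) by rewrite PE.
  rewrite big_ord_recr big_ord_recl/= mul0r addr0 addrC; congr (_ + _).
    rewrite -[RHS]comb_ind_periodic; congr (chi _).
    by rewrite /L -[in RHS]PE -natr1; ring.
  apply: eq_bigr => i _; congr (chi _); rewrite /bump/= natrD; ring.
have gd n y : g (y - n%:R * b) = g y.
  elim: n => [|n ih]; first by rewrite mul0r subr0.
  by rewrite -[RHS]ih -gb; congr (g _); rewrite -natr1; ring.
rewrite /null_fun sumrB -/(g x).
rewrite (_ : \sum_(i < P) chi (x + i%:R * b - d%:R * b) = g (x - d%:R * b)).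
  by rewrite gd subrr.
by apply: eq_bigr => i _; congr (chi _); ring.
Qed.

Lemma comb_ind_support x : chi x != 0 ->
  exists j : int, 0 <= x - s0 - j%:~R * L < eps.
Proof. by move=> /chi0_neq0; rewrite /wrap => H; exists (Num.floor ((x - s0) / L)). Qed.

Lemma null_fun_support x : null_fun x != 0 -> s0 <= wrap a x < s1.
Proof.
have key y (v : R) (zz : int) : 0 <= v -> s0 + v + eps <= s1 ->
    (exists j : int, 0 <= y - zz%:~R * a - v - s0 - j%:~R * L < eps) -> s0 <= wrap a y < s1.
  move=> v0 vs [j /andP[j0 je]].
  have jL : j%:~R * L = (j * Q)%:~R * a by rewrite /L PQ rmorphM/= mulrA.
  rewrite (@wrapE _ a a_gt0 _ (zz + j * Q)); last first.
    rewrite /tile/= in_itv/= rmorphD/= mulrDl -jL; apply/andP; split; slra.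
  by rewrite rmorphD/= mulrDl -jL; apply/andP; split; slra.
have [c1|/comb_ind_support[j H]] := eqVneq (chi x) 0; last first.
  by move=> _; apply: (key x 0 0) => //; [slra|exists j; rewrite mul0r !subr0].
rewrite /null_fun c1 sub0r oppr_eq0 => /comb_ind_support[j H].
apply: (key x e z) => //; exists j.
by rewrite (_ : x - z%:~R * a - e - s0 = x - d%:R * b - s0)// dz; ring.
Qed.

(** The first [n] teeth of the positive comb lie in [0, t) and are disjoint from the negative comb,
    so each contributes [eps] to the squared norm. *)
Lemma null_fun_growth (n : nat) : exists t : R,
  ((n%:R * eps)%:E <= \int[mu]_x ((null_fun x * chi0 t x) ^+ 2)%:E)%E.
Proof.
exists (s0 + n%:R * L + eps).
pose J j (x : R) := chi0 eps (x - (s0 + j%:R * L)).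
have mJ j : measurable_fun [set: T] (fun x : T => (J j x)%:E).
  by apply/measurable_EFinP; exact: measurable_chi0.
have J0 j (x : T) : (0 <= (J j x)%:E)%E.
  by rewrite lee_fin /J /chi0; case: ifP.
have iJ j : (\int[mu]_x (J j x)%:E = eps%:E)%E.
  transitivity (\int[mu]_x (\1_(`[(s0 + j%:R * L)%R, (s0 + j%:R * L + eps)%R[%classic : set T) x)%:E)%E.
    apply: eq_integral => x _; congr EFin; rewrite indicE mem_setE in_itv/= /J /chi0.
    by rewrite subr_ge0 ltrBlDl; case: ifP.
  rewrite integral_indic//.
  rewrite setIT; have := @lebesgue_measure_itv R `[s0 + j%:R * L, s0 + j%:R * L + eps[ => /= ->.
  rewrite lte_fin ltrDl eps_gt0 -EFinB; congr EFin; ring.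
have -> : ((n%:R * eps)%:E = \int[mu]_x \sum_(j < n) (J j x)%:E)%E.
  rewrite ge0_integral_sum//; under eq_bigr do rewrite iJ.
  by rewrite sumEFin sumr_const card_ord mulr_natl.
apply: ge0_le_integral => //.
- by move=> x _; exact: sume_ge0.
- by apply: emeasurable_sum => i.
- apply/measurable_EFinP; apply: measurable_funX; apply: measurable_funM.
    exact: measurable_null_fun.
  by have := @measurable_chi0 R (s0 + n%:R * L + eps) 0; under eq_fun do rewrite addr0.
move=> x _; rewrite sumEFin lee_fin.
have [[j /chi0_neq0 /andP[x0 xe]]|H] := pselect (exists j : 'I_n, J j x != 0); last first.
  rewrite big1 ?sqr_ge0// => j _; apply/eqP/negPn/negP => H'; apply: H; by exists j.
have JE (i : nat) : J i x != 0 -> i = j.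
  move=> /chi0_neq0 /andP[y0 ye].
  have t1 : tile L L i (x - s0).
    by rewrite /tile/= in_itv/= -pmulrn; move: bL => bL'; apply/andP; split; glra.
  have t2 : tile L L j (x - s0).
    by rewrite /tile/= in_itv/= -pmulrn; move: bL => bL'; apply/andP; split; glra.
  by have := tile_floor L_gt0 t1; rewrite (tile_floor L_gt0 t2) => -[].
rewrite (bigD1 j)//= big1 ?addr0; last first.
  by move=> i ij; apply/eqP/negPn/negP => /JE /ord_inj ij'; move: ij; rewrite ij' eqxx.
have t2 : tile L L j%:Z (x - s0).
  by rewrite /tile/= in_itv/= -pmulrn; move: bL => bL'; apply/andP; split; glra.
have -> : J j x = 1 by rewrite /J /chi0 x0 xe.
have -> : chi0 (s0 + n%:R * L + eps) x = 1.
  rewrite /chi0; have j0 : 0 <= j%:R * L by rewrite mulr_ge0// ltW.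
  have jn : j%:R * L <= n%:R * L by rewrite ler_pM2r// ler_nat ltnW// ltn_ord.
  have -> : (0 <= x) = true by apply/idP; glra.
  by have -> : (x < s0 + n%:R * L + eps) = true by apply/idP; glra.
have chi1 : chi x = 1.
  by rewrite /comb_ind (wrapE L_gt0 t2) -pmulrn /chi0 -addrA -opprD x0 xe.
(* As 0 < d < P, the shifted point lies in the preceding period, at distance at least [b], hence at
   least [eps], from its start. *)
have chi2 : chi (x - d%:R * b) = 0.
  have dR : 1 <= d%:R :> R by rewrite ler1n; case/andP: dP.
  have dPR : d%:R + 1 <= P%:R :> R by rewrite natr1 ler_nat; case/andP: dP.
  have dL : d%:R * b + b <= L by rewrite /L -[X in _ + X]mul1r -mulrDl ler_pM2r.
  have db : b <= d%:R * b by rewrite -[leLHS]mul1r ler_pM2r.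
  rewrite /comb_ind (@wrapE _ L L_gt0 _ (j%:Z - 1)); last first.
    by rewrite /tile/= in_itv/= rmorphB/= -pmulrn mulrBl mul1r; apply/andP; split; glra.
  rewrite /chi0 rmorphB/= -pmulrn mulrBl mul1r.
  have -> : (x - d%:R * b - s0 - (j%:R * L - L) < eps) = false.
    by apply/negbTE; rewrite -leNgt; glra.
  by rewrite andbF.
by rewrite /null_fun chi1 chi2 subr0 mulr1 expr1n.
Qed.

End periodic_null.

(** * Truncation of a bounded function with vanishing window sums *)

Section not_frame.
Context {R : realType}.
Local Notation mu := (@lebesgue_measure R).
Local Notation T := (measurableTypeR R).
Variables (a b c0 : R) (k : nat).
Let c := k%:R * b + c0.
Hypotheses (a_gt0 : 0 < a) (ab : a < b) (c0_gt : b - a < c0) (c0_lt : c0 < a).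
Local Ltac slra := move: (a_gt0) (ab) (c0_gt) (c0_lt); lra.

Let b_gt0 : 0 < b. Proof. exact: lt_trans ab. Qed.
Let cb : c <= k.+1%:R * b.
Proof. by rewrite /c -natr1 mulrDl mul1r lerD2l ltW// (lt_trans c0_lt). Qed.

(** After truncation to [0, t) only windows meeting an end of the interval can have a nonzero sum.
    Their energy is bounded by [E] independently of [t], whereas the squared norm is at least
    [n * eps] for a suitable [t]. *)
Lemma not_frame_of_null (phi : R -> R) (eps : R) : 0 < eps ->
  measurable_fun [set: T] (phi : T -> R) -> (forall x, `|phi x| <= 1) ->
  (forall m x, tile a b m x -> window a b c k m phi x = 0) ->
  (forall n : nat, exists t : R,
    ((n%:R * eps)%:E <= \int[mu]_x ((phi x * chi0 t x) ^+ 2)%:E)%E) ->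
  ~ gabor_frame (chi0 c) (@zero_fun R) a b.
Proof.
move=> eps0 mphi phi1 phi0 growth [A [B [A0 [_ H]]]].
have kb : 0 <= k%:R * b by rewrite mulr_ge0// ltW.
pose C := b * k.+1%:R ^+ 2.
have C0 : 0 <= C by rewrite mulr_ge0 ?sqr_ge0// ltW.
pose E := 2 * (C * (k%:R * b) + C * (k%:R * b)).
suff bd (n : nat) : A * (n%:R * eps) <= E.
  have Ae : 0 < A * eps by rewrite mulr_gt0.
  have := bd (Num.truncn (E / (A * eps))).+1.
  have := truncnS_gt (E / (A * eps)); rewrite ltr_pdivrMr// mulrCA => h1 h2.
  by have := lt_le_trans h1 h2; rewrite ltxx.
have [t gt] := growth n.
pose f x := phi x * chi0 t x.
have f1 x : `|f x| <= 1 by rewrite normrM mulr_ile1 ?chi0_le1.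
have mf : measurable_fun [set: T] (f : T -> R).
  apply: measurable_funM => //.
  by have := @measurable_chi0 R t 0; under eq_fun do rewrite addr0.
have en : (energy a b c k f <= E%:E)%E.
  (* The two indicators mark [- k b, 0) and [t - k b, t), the positions from which the points x,
     ..., x + k b may cross 0 or t; [C] bounds the energy density of any window. *)
  pose g (x : T) : \bar R := ((C * chi0 (k%:R * b) (x + k%:R * b))%:E +
    (C * chi0 (k%:R * b) (x + (k%:R * b - t)))%:E)%E.
  have m1 h : measurable_fun [set: T] (fun x : T => (C * chi0 (k%:R * b) (x + h))%:E).
    by apply/measurable_EFinP; apply: measurable_funM => //; exact: measurable_chi0.
  have p1 h (x : T) : (0 <= (C * chi0 (k%:R * b) (x + h))%:E)%E.
    by rewrite lee_fin mulr_ge0// /chi0; case: ifP.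
  have mg : measurable_fun [set: T] g by apply: emeasurable_funD.
  have g0 x : (0 <= g x)%E by apply: adde_ge0.
  have i1 h : (\int[mu]_x (C * chi0 (k%:R * b) (x + h))%:E <= (C * (k%:R * b))%:E)%E.
    rewrite (@ge0_integral_shiftT _ h (fun x : T => (C * chi0 (k%:R * b) x)%:E)); last 2 first.
    - by have := m1 0; under eq_fun do rewrite addr0.
    - by move=> x; have := p1 0 x; rewrite addr0.
    under eq_integral do rewrite (EFinM C).
    have m0 : measurable_fun [set: T] (fun x : T => (chi0 (k%:R * b) x)%:E).
      apply/measurable_EFinP; have := @measurable_chi0 R (k%:R * b) 0.
      by under eq_fun do rewrite addr0.
    rewrite ge0_integralZl// ?lee_fin//; last first.
      by move=> x _; rewrite lee_fin /chi0; case: ifP.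
    rewrite (EFinM C (k%:R * b)); apply: lee_pmul => //.
      by apply: integral_ge0 => x _; rewrite lee_fin /chi0; case: ifP.
    under eq_integral do rewrite chi0E.
    rewrite integral_indic//.
    rewrite setIT; have := @lebesgue_measure_itv R `[0, k%:R * b[ => /= ->.
    by case: ifP => _; rewrite ?sube0 ?lee_fin.
  apply: (@le_trans _ _ (\esum_(m in [set: int]) \int[mu]_(x in tile a b m) g x)%E).
    apply: le_esum => m _; apply: ge0_le_integral => //.
    - exact: measurable_itv.
    - by move=> x _; rewrite lee_fin mulr_ge0 ?sqr_ge0// ltW.
    - by apply: measurable_funTS; exact: measurable_window.
    - exact: measurable_funTS.
    move=> x xm.
    have wle : b * window a b c k m f x ^+ 2 <= C.
      rewrite /C ler_pM2l// -real_normK ?num_real// lerXn2r ?nnegrE//.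
      apply: le_trans (ler_norm_sum _ _ _) _.
      apply: (@le_trans _ _ (\sum_(i < k.+1) 1)); last by rewrite sumr_const card_ord.
      by apply: ler_sum => i _; rewrite normrM mulr_ile1// chi0_le1.
    have ib (i : 'I_k.+1) : 0 <= i%:R * b <= k%:R * b.
      apply/andP; split; first by apply: mulr_ge0 => //; exact: ltW.
      by rewrite ler_pM2r// ler_nat; exact: (ltn_ord i).
    rewrite /g -EFinD lee_fin.
    have c1 h : 0 <= C * chi0 (k%:R * b) (x + h).
      by rewrite mulr_ge0// /chi0; case: ifP.
    have [n1|y1] := boolP ((0 <= x + k%:R * b) && (x + k%:R * b < k%:R * b)).
      by apply: le_trans wle _; rewrite [X in X + _](_ : _ = C) ?lerDl// /chi0 n1 mulr1.
    have [n2|y2] := boolP ((0 <= x + (k%:R * b - t)) && (x + (k%:R * b - t) < k%:R * b)).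
      by apply: le_trans wle _; rewrite [X in _ + X](_ : _ = C) ?lerDr// /chi0 n2 mulr1.
    suff -> : window a b c k m f x = 0 by rewrite expr0n mulr0 addr_ge0.
    have [xk|xk] := ltP (x + k%:R * b) 0.
      rewrite /window big1// => i _; rewrite /f /(chi0 t).
      have /andP[i0 ik] := ib i.
      have -> : (0 <= x + i%:R * b) = false by apply/negbTE; rewrite -ltNge; lra.
      by rewrite mulr0 mul0r.
    have [tx|tx] := leP t x.
      rewrite /window big1// => i _; rewrite /f /(chi0 t).
      have /andP[i0 ik] := ib i.
      have -> : (x + i%:R * b < t) = false by apply/negbTE; rewrite -leNgt; lra.
      by rewrite andbF mulr0 mul0r.
    rewrite -(phi0 m x xm); apply: eq_bigr => i _; congr (_ * _); rewrite /f /(chi0 t).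
    have /andP[i0 ik] := ib i.
    move: y1 y2; rewrite !negb_and -!leNgt -!ltNge => y1 y2.
    have -> : (0 <= x + i%:R * b) = true.
      by apply/idP; case/orP: y1 => ?; lra.
    have -> : (x + i%:R * b < t) = true.
      by apply/idP; case/orP: y2 => ?; lra.
    by rewrite mulr1.
  apply: le_trans (esum_tile_le a_gt0 _ mg g0) _; first slra.
  rewrite ge0_integralD// /E (EFinM 2); apply: lee_pmul => //.
    by apply: adde_ge0; apply: integral_ge0.
  by rewrite EFinD; apply: leeD; exact: i1.
have z2 : L2r (@zero_fun R).
  split; first exact: measurable_cst.
  by under eq_integral do rewrite /zero_fun expr0n; rewrite integral0 ltry.
have ez : energy a b c k (@zero_fun R) = 0%E.
  rewrite /energy esum1// => m _; rewrite integral0_eq// => x _.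
  by rewrite /window big1 ?expr0n ?mulr0// => i _; rewrite /zero_fun mul0r.
have Lf : L2r f.
  split; first exact: mf.
  apply: (@le_lt_trans _ _ (\int[mu]_x (chi0 t x)%:E)%E).
    apply: ge0_le_integral => //.
    - by move=> x _; rewrite lee_fin sqr_ge0.
    - by apply/measurable_EFinP; apply: measurable_funX.
    - apply/measurable_EFinP; have := @measurable_chi0 R t 0.
      by under eq_fun do rewrite addr0.
    - move=> x _; rewrite lee_fin /f /(chi0 t); case: ifP => _; rewrite ?mulr0 ?expr0n// mulr1.
      by rewrite -real_normK ?num_real// exprn_ile1.
  under eq_integral do rewrite chi0E.
  rewrite integral_indic//.
  rewrite setIT; have := @lebesgue_measure_itv R `[0, t[ => /= ->.
  by case: ifP => _; rewrite ?sube0 ltry.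
have [lower _] := H f (@zero_fun R) (conj Lf z2).
move: lower; rewrite (gabor_sum_energy a b_gt0 cb (conj Lf z2)) ez adde0 => lower.
rewrite -lee_fin (EFinM A); apply: le_trans (le_trans lower en).
apply: lee_pmul => //; rewrite ?lee_fin; [exact: ltW|by rewrite mulr_ge0// ltW|].
apply: (le_trans gt); rewrite /sqnorm2 le_eqVlt; apply/orP; left; apply/eqP.
by apply: eq_integral => x _; rewrite /zero_fun expr0n addr0.
Qed.

Lemma not_frame_left_fixed (d : nat) (Q z : int) (e : R) : (0 < d < k.+1)%N ->
  k.+1%:R * b = Q%:~R * a -> d%:R * b = z%:~R * a + e -> 0 <= e < c0 + a - b ->
  ~ gabor_frame (chi0 c) (@zero_fun R) a b.
Proof.
move=> dk kQ dz /andP[e0 el].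
pose eps := Num.min b (c0 + a - b - e).
have eps0 : 0 < eps by rewrite lt_min b_gt0 subr_gt0.
have epsb : eps <= b by rewrite ge_min lexx.
have epse : eps <= c0 + a - b - e by rewrite ge_min lexx orbT.
have s1 : 0 + e + eps <= c0 + a - b by lra.
have s2 : c0 + a - b <= a by slra.
pose phi := null_fun b k.+1 d 0 eps.
have supp x : phi x != 0 -> 0 <= wrap a x < c0 + a - b.
  exact: (null_fun_support a_gt0 b_gt0 kQ dz (lexx (0 : R)) e0 eps0 epsb s1 s2).
apply: (@not_frame_of_null phi eps) => //.
- exact: measurable_null_fun.
- exact: null_fun_le1.
- move=> m x xm; rewrite window_run//.
  have := sum_null_fun 0 eps b_gt0 dk x; rewrite -/phi big_ord_recr/= => H.
  rewrite /run.
  have [uc|uc] := ltP (x - m%:~R * a) c0.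
    rewrite /chi0 uc andbT (_ : (0 <= x - _) = true) ?mulr1//.
    by move: xm; rewrite /tile/= in_itv/= => /andP[xm _]; apply/idP; lra.
  have -> : chi0 c0 (x - m%:~R * a) = 0 by rewrite /chi0 (ltNge _ c0) uc andbF.
  rewrite mulr0 addr0.
  suff p0 : phi (x + k%:R * b) = 0 by move: H; rewrite p0 addr0.
  (* The missing last point is moved back by the period (k + 1) b. Its residue is then u + a - b
     with u >= c0, hence not before the hole, where [phi] vanishes. *)
  have -> : phi (x + k%:R * b) = phi (x - b).
    rewrite /phi -(null_fun_periodic 0 eps b_gt0 dk (x - b)); congr null_fun.
    by rewrite -natr1; ring.
  apply/eqP/negPn/negP => /supp /andP[_].
  rewrite (@wrapE _ a a_gt0 _ (m - 1)).
    by rewrite rmorphB/= mulrBl mul1r; slra.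
  move: xm; rewrite /tile/= !in_itv/= rmorphB/= mulrBl mul1r => /andP[? ?].
  by apply/andP; split; slra.
- by move=> n; exact: (null_fun_growth b_gt0 dk (lexx (0 : R)) eps0 epsb).
Qed.

Lemma not_frame_right_fixed (d : nat) (Q z : int) (e : R) : (0 < d < k)%N ->
  k%:R * b = Q%:~R * a -> d%:R * b = z%:~R * a + e -> 0 <= e < a - c0 ->
  ~ gabor_frame (chi0 c) (@zero_fun R) a b.
Proof.
move=> dk kQ dz /andP[e0 el].
pose eps := Num.min b (a - c0 - e).
have eps0 : 0 < eps by rewrite lt_min b_gt0 subr_gt0.
have epsb : eps <= b by rewrite ge_min lexx.
have epse : eps <= a - c0 - e by rewrite ge_min lexx orbT.
have s1 : c0 + e + eps <= a by lra.
have s0 : 0 <= c0 by slra.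
pose phi := null_fun b k d c0 eps.
have supp x : phi x != 0 -> c0 <= wrap a x < a.
  exact: (null_fun_support a_gt0 b_gt0 kQ dz s0 e0 eps0 epsb s1 (lexx a)).
apply: (@not_frame_of_null phi eps) => //.
- exact: measurable_null_fun.
- exact: null_fun_le1.
- move=> m x xm; rewrite window_run// /run.
  rewrite (sum_null_fun c0 eps b_gt0 dk x) add0r.
  have -> : phi (x + k%:R * b) = phi x by exact: null_fun_periodic.
  have [uc|uc] := ltP (x - m%:~R * a) c0; last first.
    by rewrite /chi0 (ltNge _ c0) uc andbF mulr0.
  (* The extra last point is counted only when the residue of [x] is below [c0], outside the support
     of [phi]. *)
  suff -> : phi x = 0 by rewrite mul0r.
  apply/eqP/negPn/negP => /supp /andP[+ _].
  rewrite (@wrapE _ a a_gt0 _ m); first lra.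
  move: xm; rewrite /tile/= !in_itv/= => /andP[? ?].
  by apply/andP; split; slra.
- by move=> n; exact: (null_fun_growth b_gt0 dk s0 eps0 epsb).
Qed.

End not_frame.

(** * Distances between multiples of b modulo a *)

Section separation.
Context {R : realType}.
Variables (a b : R).
Hypotheses (a_gt0 : 0 < a) (b_gt0 : 0 < b).

(** The difference is (i q - y p) b / q, and the integer factor is nonzero since [p] is coprime to
    [q] and does not divide [i]. *)
Lemma coprime_separation (p q : nat) : (0 < p)%N -> (0 < q)%N -> coprime p q ->
  a / b = p%:R / q%:R -> forall (i : nat) (y : int), (0 < i < p)%N ->
  b / q%:R <= `|i%:R * b - y%:~R * a|.
Proof.
move=> p0 q0 pq E i y /andP[i0 ip].
have q0R : 0 < q%:R :> R by rewrite ltr0n.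
have aE : a = p%:R * (b / q%:R).
  by have -> : a = (a / b) * b; [field; rewrite gt_eqF|rewrite E; field; rewrite gt_eqF].
pose n : int := i%:Z * q%:Z - y * p%:Z.
have -> : i%:R * b - y%:~R * a = n%:~R * (b / q%:R).
  rewrite /n rmorphB/= !rmorphM/= -!pmulrn [in LHS]aE.
  by field; rewrite gt_eqF.
have bq : 0 < b / q%:R by rewrite divr_gt0.
rewrite normrM (gtr0_norm bq) ler_peMl ?(ltW bq)// -intr_norm -[leLHS]/(1%:~R) ler_int.
rewrite -gtz0_ge1 normr_gt0; apply/negP => /eqP n0.
have : (p %| i * q)%N.
  have e : i%:Z * q%:Z = y * p%:Z by apply/eqP; rewrite -subr_eq0 -/n n0.
  have : (p%:Z %| (i * q)%N%:Z)%Z by rewrite PoszM e; exact: dvdz_mull.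
  by rewrite dvdzE.
rewrite Gauss_dvdl// => /(dvdn_leq i0); rewrite leqNgt ip//.
Qed.

(** A common factor g would give the multiple d = P / g with residue 0, against [l > 0]. A Bezout
    relation d Q = z P + 1 gives a multiple with residue exactly b / Q. *)
Lemma separation_coprime (P Q : nat) (l : R) : (1 < P)%N -> (0 < Q)%N ->
  P%:R * b = Q%:R * a -> 0 < l ->
  (forall (d : nat) (z : int) (e : R), (0 < d < P)%N -> d%:R * b = z%:~R * a + e ->
     0 <= e -> l <= e) ->
  coprime P Q /\ l <= b / Q%:R.
Proof.
move=> P1 Q0 PQ l0 H; have P0 := ltnW P1.
have Q0R : 0 < Q%:R :> R by rewrite ltr0n.
have P0R : 0 < P%:R :> R by rewrite ltr0n.
have cPQ : coprime P Q.
  apply: contraT => ncop.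
  have g1 : (1 < gcdn P Q)%N.
    by rewrite ltn_neqAle gcdn_gt0 P0 andbT eq_sym.
  have g0R : 0 < (gcdn P Q)%:R :> R by rewrite ltr0n ltnW.
  have PE : P%:R = (P %/ gcdn P Q)%:R * (gcdn P Q)%:R :> R.
    by rewrite -natrM divnK// dvdn_gcdl.
  have QE : Q%:R = (Q %/ gcdn P Q)%:R * (gcdn P Q)%:R :> R.
    by rewrite -natrM divnK// dvdn_gcdr.
  suff : l <= 0 by rewrite leNgt l0.
  apply: (H (P %/ gcdn P Q)%N (Q %/ gcdn P Q)%N%:Z) => //.
    by rewrite divn_gt0 ?gcdn_gt0 ?P0// dvdn_leq ?dvdn_gcdl//= ltn_Pdiv.
  rewrite addr0 -pmulrn; apply: (mulIf (lt0r_neq0 g0R)).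
  by rewrite mulrAC -PE mulrAC -QE.
split=> //.
have [[u v] /= uv] := coprimeP _ Q0 (eq_ind _ is_true cPQ _ (coprime_sym P Q)).
have uvE : (u * Q = v * P + 1)%N.
  by rewrite -uv addnC subnK//; apply: ltnW; rewrite -subn_gt0 uv.
pose d := (u %% P)%N; pose z : int := v%:Z - (u %/ P)%N%:Z * Q%:Z.
have dE : (d%:Z * Q%:Z = z * P%:Z + 1)%R.
  have uE : u%:Z = (u %/ P)%N%:Z * P%:Z + d%:Z by rewrite {1}(divn_eq u P) PoszD PoszM.
  have -> : d%:Z = u%:Z - (u %/ P)%N%:Z * P%:Z by rewrite uE addrC addKr.
  have uv' : u%:Z * Q%:Z = v%:Z * P%:Z + 1 by rewrite -PoszM uvE PoszD PoszM.
  by rewrite /z mulrBl uv'; ring.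
have d0 : (0 < d)%N.
  rewrite lt0n; apply/eqP => d0; move: dE; rewrite d0 mul0r => /esym/eqP.
  rewrite addr_eq0 => /eqP e; have := dvdz_mull z (dvdzz P%:Z).
  by rewrite e dvdzE/= dvdn1 gtn_eqF.
apply: (H d z) => //.
- by rewrite d0 ltn_mod.
- have dR : d%:R * Q%:R = z%:~R * P%:R + 1 :> R.
    have := congr1 (fun n : int => n%:~R : R) dE.
    by rewrite rmorphD/= !rmorphM/= -!pmulrn.
  apply: (mulIf (lt0r_neq0 P0R)).
  rewrite mulrDl [b / _]mulrC -[_^-1 * b * _]mulrA [b * _]mulrC PQ.
  rewrite -mulrA [b * _]mulrC PQ mulrA dR.
  by field; rewrite gt_eqF.
- by rewrite divr_ge0// ltW.
Qed.

End separation.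

Theorem theorem2p3 (R : realType) (a b c : R) :
  0 < a -> a < b -> b < c ->
  let k : int := Num.floor (c / b) in
  let c0 : R := c - k%:~R * b in
  let c1 : R := k%:~R * b - (Num.floor (k%:~R * b / a))%:~R * a in
  b - a < c0 -> c0 < a -> (2 <= k)%R ->
  (* (IX) *)
  (2 * a - b < c1 -> gabor_frame (chi0 c) (@zero_fun R) a b) /\
  (* (X) *)
  (c1 = 2 * a - b ->
     (gabor_frame (chi0 c) (@zero_fun R) a b <->
      exists p q : nat, (0 < p)%N /\ (0 < q)%N /\ coprime p q /\
        a / b = p%:R / q%:R /\ c0 <= b - a + b / q%:R /\ k + 1 = p%:Z)) /\
  (* (XI) *)
  (c1 = 0 ->
     (gabor_frame (chi0 c) (@zero_fun R) a b <->
      exists p q : nat, (0 < p)%N /\ (0 < q)%N /\ coprime p q /\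
        a / b = p%:R / q%:R /\ a - b / q%:R <= c0 /\ k = p%:Z)).
Proof.
move=> a0 ab bc k c0 c1 c0gt c0lt k2.
have b0 : 0 < b by exact: lt_trans ab.
set z0 : int := Num.floor (k%:~R * b / a) in c1 *.
have c1a : 0 <= c1 < a by exact: (wrap_itv a0 (k%:~R * b)).
have cE : c = k%:~R * b + c0 by rewrite /c0; ring.
have kbE : k%:~R * b = z0%:~R * a + c1 by rewrite /c1; ring.
move: c1 c1a kbE => c1 c1a kbE.
move: c0 c0gt c0lt cE => c0 c0gt c0lt ->.
case: k k2 z0 kbE => [k|//] k2 z0; rewrite -!pmulrn => kbE.
have {}k2 : (2 <= k)%N by [].
have k0 : (0 < k)%N by exact: ltnW.
have int_pos (n : nat) (z : int) : (0 < n)%N -> n%:R * b = z%:~R * a ->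
    exists2 q : nat, (0 < q)%N & z = q%:Z.
  move=> n0 nz; have : 0 < z%:~R * a by rewrite -nz mulr_gt0// ltr0n.
  rewrite pmulr_lgt0// ltr0z; case: z {nz} => [q q0|//]; by exists q.
have ratio (n q : nat) : (0 < q)%N -> n%:R * b = q%:R * a -> a / b = n%:R / q%:R.
  move=> q0 e; have q0R : 0 < q%:R :> R by rewrite ltr0n.
  have -> : a = (q%:R * a) / q%:R by field; rewrite gt_eqF.
  by rewrite -e; field; rewrite !gt_eqF.
have kS : k.+1%:R * b = k%:R * b + b by rewrite -natr1; ring.
split; [|split].
- move=> c1gt.
  (* From k b = z0 a + c1: adding b and removing two more multiples of a leaves c1 + b - 2 a,
     positive by hypothesis; the next multiple of a lies a - c1 above k b, which is below b - a by
     the same hypothesis. *)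
  apply: (@frame_generic R a b c0 k a0 ab c0gt c0lt k0 (z0 + 2) (z0 + 1) (c1 + b - 2 * a) (a - c1)).
  + by rewrite kS kbE rmorphD/=; ring.
  + by apply/andP; split; lra.
  + by rewrite kbE rmorphD/=; ring.
  + by apply/andP; split; lra.
- move=> c1E.
  have PQ : k.+1%:R * b = (z0 + 2)%:~R * a by rewrite kS kbE c1E rmorphD/=; ring.
  have [Q Q0 QE] := int_pos _ _ (ltn0Sn k) PQ; move: PQ; rewrite QE -pmulrn => PQ.
  split.
    move=> fr.
    (* The length of the side before the hole: a residue shorter than it would give two classes
       there and hence a null function. *)
    have [|||||cPQ lQ] := @separation_coprime R a b b0 k.+1 Q (c0 + a - b) => //.
    + by lra.
    + move=> d z e dk dz e0; rewrite leNgt; apply/negP => el.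
      apply: (@not_frame_left_fixed R a b c0 k a0 ab c0gt c0lt d Q%:Z z e) => //.
      by rewrite e0.
    exists k.+1, Q; split=> //; split=> //; split=> //; split; first exact: ratio.
    by split; [lra|rewrite -PoszD addn1].
  move=> [p [q [p0 [q0 [pq [E [lq]]]]]]]; rewrite -PoszD addn1 => -[pE]; move: p0 pq E; rewrite -pE => p0 pq E.
  apply: (@frame_left_fixed R a b c0 k a0 ab c0gt c0lt k0 Q%:Z) => // i y ik.
  by have := coprime_separation b0 p0 q0 pq E y ik; lra.
- move=> c1E.
  have PQ : k%:R * b = z0%:~R * a by rewrite kbE c1E addr0.
  have [Q Q0 QE] := int_pos _ _ k0 PQ; move: PQ; rewrite QE -pmulrn => PQ.
  split.
    move=> fr.
    (* Now the side after the hole; the assumption k >= 2 supplies the condition 1 < P of this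
       lemma. *)
    have [|||||cPQ lQ] := @separation_coprime R a b b0 k Q (a - c0) => //.
    + by lra.
    + move=> d z e dk dz e0; rewrite leNgt; apply/negP => el.
      apply: (@not_frame_right_fixed R a b c0 k a0 ab c0gt c0lt d Q%:Z z e) => //.
      by rewrite e0.
    exists k, Q; split=> //; split=> //; split=> //; split; first exact: ratio.
    by split; [lra|].
  move=> [p [q [p0 [q0 [pq [E [lq [pE]]]]]]]]; move: p0 pq E; rewrite -pE => p0 pq E.
  apply: (@frame_right_fixed R a b c0 k a0 ab c0gt c0lt k0 Q%:Z) => // i y ik.
  by have := coprime_separation b0 p0 q0 pq E y ik; lra.
Qed.
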